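(* INF proves: if Frege successor maps $\mathbb{F}$ to $\mathbb{F}$ (i.e. $x^+\in\mathbb{F}$ for every $x\in\mathbb{F}$, where $\mathbb{F}$ is the set of finite Frege cardinals), then the set $\mathbb{N}$ of Church numbers is infinite and Church successor is one-to-one on $\mathbb{N}$ (for all $x,y\in\mathbb{N}$, $\mathsf{S}x=\mathsf{S}y\to x=y$).
   Context: INF (intuitionistic New Foundations) is the first-order theory with equality over intuitionistic logic, with one binary predicate $\in$, whose axioms are extensionality ($\forall z(z\in x\leftrightarrow z\in y)\to x=y$) and stratified comprehension (the set $\{x:\varphi\}$ exists for every stratified $\varphi$, parameters allowed; $\varphi$ is stratified if its variables can be assigned natural-number indices so that in each subformula $x\in y$ the index of $y$ is one more than that of $x$, and in each $x=y$ the indices agree). Ordered pairs are $\langle x,y\rangle=\{\{x\},\{x,y\}\}$. $\mathrm{FUNC}=\{f:\forall x,y,z(\langle x,y\rangle\in f\to\langle x,z\rangle\in f\to y=z)\}$. Application: $Ap(f,x)=\{t:\exists y(\langle x,y\rangle\in f\land t\in y)\}$, so $Ap(f,x)=y$ if $f\in\mathrm{FUNC}$ and $\langle x,y\rangle\in f$. Write $fx$ for $Ap(f,x)$, associating to the left. Church numbers: $\mathbf{0}=\{\langle f,\mathrm{id}\rangle: f=f\}$ with $\mathrm{id}=\{\langle x,x\rangle:x=x\}$. Church successor is the set of all pairs $\langle z,s_z\rangle$ with $z\in\mathrm{FUNC}$, where $s_z$ is the set of all $\langle f,p\rangle$ with $f\in\mathrm{FUNC}$ and $\forall u\,(u\in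 p\leftrightarrow\exists x,w,t,q\,(u=\langle x,w\rangle\land t\in\mathrm{FUNC}\land\langle f,t\rangle\in z\land\langle x,q\rangle\in t\land\langle q,w\rangle\in f))$; it is denoted $\mathsf{S}$. $\mathbb{N}$ is the intersection of all sets containing $\mathbf{0}$ and closed under $\mathsf{S}$. Frege cardinals: $\mathsf{zero}=\{\emptyset\}$; the Frege successor of $x$ is $x^+=\{u\cup\{c\}: u\in x,\ c\notin u\}$; $\mathbb{F}$ is the least set containing $\mathsf{zero}$ and closed under inhabited successor, i.e. the intersection of all sets $w$ with $\mathsf{zero}\in w$ and $\forall x\,(x\in w\land\exists u(u\in x^+)\to x^+\in w)$. A set $X$ is infinite (Dedekind) if there is $Y\subseteq X$ with $Y\neq X$ and $X\sim Y$, where $X\sim Y$ means that some relation is a one-to-one function from $X$ onto $Y$. *)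

(* Defs.v *)
From Stdlib Require Import List.

(** Variables are de Bruijn indices; the language has no function symbols,
    so variables are the only terms and substitutions are renamings. *)

Inductive form : Type :=
| Eq (x y : nat)
| Mem (x y : nat)
| Bot
| And (p q : form)
| Or (p q : form)
| Imp (p q : form)
| All (p : form)
| Ex (p : form).

Definition Iff (p q : form) : form := And (Imp p q) (Imp q p).

Definition scons (x : nat) (e : nat -> nat) (i : nat) : nat :=
  match i with 0 => x | S j => e j end.

Definition up (r : nat -> nat) : nat -> nat := scons 0 (fun i => S (r i)).

Fixpoint ren (r : nat -> nat) (p : form) : form :=
  match p with
  | Eq x y => Eq (r x) (r y)
  | Mem x y => Mem (r x) (r y)
  | Bot => Bot
  | And p q => And (ren r p) (ren r q)
  | Or p q => Or (ren r p) (ren r q)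
  | Imp p q => Imp (ren r p) (ren r q)
  | All p => All (ren (up r) p)
  | Ex p => Ex (ren (up r) p)
  end.

Definition shift : form -> form := ren S.
Definition inst (t : nat) : form -> form := ren (scons t (fun i => i)).

(** Free variables of axioms are read universally: [AllI] may generalize over
    them, so an open axiom amounts to its universal closure. *)

Inductive prv (Ax : form -> Prop) : list form -> form -> Prop :=
| Hyp G p : In p G -> prv Ax G p
| Axm G p : Ax p -> prv Ax G p
| BotE G p : prv Ax G Bot -> prv Ax G p
| AndI G p q : prv Ax G p -> prv Ax G q -> prv Ax G (And p q)
| AndE1 G p q : prv Ax G (And p q) -> prv Ax G p
| AndE2 G p q : prv Ax G (And p q) -> prv Ax G q
| OrI1 G p q : prv Ax G p -> prv Ax G (Or p q)
| OrI2 G p q : prv Ax G q -> prv Ax G (Or p q)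
| OrE G p q r :
    prv Ax G (Or p q) -> prv Ax (p :: G) r -> prv Ax (q :: G) r -> prv Ax G r
| ImpI G p q : prv Ax (p :: G) q -> prv Ax G (Imp p q)
| ImpE G p q : prv Ax G (Imp p q) -> prv Ax G p -> prv Ax G q
| AllI G p : prv Ax (map shift G) p -> prv Ax G (All p)
| AllE G p t : prv Ax G (All p) -> prv Ax G (inst t p)
| ExI G p t : prv Ax G (inst t p) -> prv Ax G (Ex p)
| ExE G p q :
    prv Ax G (Ex p) -> prv Ax (p :: map shift G) (shift q) -> prv Ax G q
| EqI G x : prv Ax G (Eq x x)
| EqE G p x y : prv Ax G (Eq x y) -> prv Ax G (inst x p) -> prv Ax G (inst y p).

(** [strat e p]: the free variables of [p] have the indices given by [e], and
    every bound variable can be given an index. *)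
Fixpoint strat (e : nat -> nat) (p : form) : Prop :=
  match p with
  | Eq x y => e x = e y
  | Mem x y => e y = S (e x)
  | Bot => True
  | And p q | Or p q | Imp p q => strat e p /\ strat e q
  | All p | Ex p => exists n, strat (scons n e) p
  end.

Definition stratified (p : form) : Prop := exists e, strat e p.

(** In [INF_comp], variable 0 of [p] is the comprehension variable and the
    others are parameters; the renaming keeps the new set out of [p]. *)
Inductive INF : form -> Prop :=
| INF_ext :
    INF (All (All (Imp (All (Iff (Mem 0 2) (Mem 0 1))) (Eq 1 0))))
| INF_comp p :
    stratified p -> INF (Ex (All (Iff (Mem 0 1) (ren (up S) p)))).

(** Bound variables are first given by their level (the number of enclosing
    binders); an [sform] yields a de Bruijn formula once the number of
    enclosing binders is known. *)

Definition sform : Type := nat -> form.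

Definition sex (f : nat -> sform) : sform := fun d => Ex (f d (S d)).
Definition sall (f : nat -> sform) : sform := fun d => All (f d (S d)).
Definition smem (x y : nat) : sform := fun d => Mem (d - S x) (d - S y).
Definition seql (x y : nat) : sform := fun d => Eq (d - S x) (d - S y).
Definition sbot : sform := fun _ => Bot.
Definition sand (p q : sform) : sform := fun d => And (p d) (q d).
Definition sor (p q : sform) : sform := fun d => Or (p d) (q d).
Definition simp (p q : sform) : sform := fun d => Imp (p d) (q d).
Definition siff (p q : sform) : sform := fun d => Iff (p d) (q d).
Definition snot (p : sform) : sform := simp p sbot.

Definition closed (p : sform) : form := p 0.

(** A term [t] is identified with the map sending a context [Q] to the formula
    Q(t). Abstracts are eliminated by
    Q({x : P x}) := exists a, (forall x, x in a <-> P x) /\ Q(a),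
    in the smallest context, that of the atomic formula. *)

Definition term : Type := (nat -> sform) -> sform.

Definition var (x : nat) : term := fun Q => Q x.

Definition tall (f : term -> sform) : sform := sall (fun x => f (var x)).
Definition tex (f : term -> sform) : sform := sex (fun x => f (var x)).
Definition tmem (s t : term) : sform := s (fun a => t (fun b => smem a b)).
Definition teq (s t : term) : sform := s (fun a => t (fun b => seql a b)).

Definition setof (P : term -> sform) : term := fun Q =>
  sex (fun a => sand (sall (fun x => siff (smem x a) (P (var x)))) (Q a)).

Declare Scope inf_scope.
Open Scope inf_scope.

Notation "s ∈ t" := (tmem s t) (at level 70, no associativity) : inf_scope.
Notation "s ≡ t" := (teq s t) (at level 70, no associativity) : inf_scope.
Notation "¬ p" := (snot p) (at level 75, right associativity) : inf_scope.
Notation "p ∧ q" := (sand p q) (at level 80, right associativity) : inf_scope.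
Notation "p ∨ q" := (sor p q) (at level 85, right associativity) : inf_scope.
Notation "p ⇒ q" := (simp p q) (at level 90, right associativity) : inf_scope.
Notation "p ⇔ q" := (siff p q) (at level 95, no associativity) : inf_scope.
Notation "∀ x .. y , p" := (tall (fun x => .. (tall (fun y => p)) ..))
  (at level 200, x binder, y binder, right associativity) : inf_scope.
Notation "∃ x .. y , p" := (tex (fun x => .. (tex (fun y => p)) ..))
  (at level 200, x binder, y binder, right associativity) : inf_scope.
Notation "⦃ x | p ⦄" := (setof (fun x => p)) (x name) : inf_scope.

Definition empty : term := ⦃ z | sbot ⦄.
Definition sing (x : term) : term := ⦃ z | z ≡ x ⦄.
Definition upair (x y : term) : term := ⦃ z | z ≡ x ∨ z ≡ y ⦄.
Definition union (x y : term) : term := ⦃ z | z ∈ x ∨ z ∈ y ⦄.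
Definition pair (x y : term) : term := upair (sing x) (upair x y).

Notation "⟨ x , y ⟩" := (pair x y) : inf_scope.

Definition FUNC : term :=
  ⦃ f | ∀ x y z, ⟨x, y⟩ ∈ f ⇒ ⟨x, z⟩ ∈ f ⇒ y ≡ z ⦄.

Definition Ap (f x : term) : term := ⦃ t | ∃ y, ⟨x, y⟩ ∈ f ∧ t ∈ y ⦄.

Definition subset (x y : term) : sform := ∀ z, z ∈ x ⇒ z ∈ y.

Definition bijection (f x y : term) : sform :=
  (∀ u, u ∈ f ⇒ ∃ a b, u ≡ ⟨a, b⟩ ∧ a ∈ x ∧ b ∈ y) ∧
  f ∈ FUNC ∧
  (∀ a, a ∈ x ⇒ ∃ b, ⟨a, b⟩ ∈ f) ∧
  (∀ a b c, ⟨a, c⟩ ∈ f ⇒ ⟨b, c⟩ ∈ f ⇒ a ≡ b) ∧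
  (∀ b, b ∈ y ⇒ ∃ a, ⟨a, b⟩ ∈ f).

Definition similar (x y : term) : sform := ∃ f, bijection f x y.

Definition infinite (x : term) : sform :=
  ∃ y, subset y x ∧ ¬ (y ≡ x) ∧ similar x y.

Definition idset : term := ⦃ v | ∃ x, v ≡ ⟨x, x⟩ ∧ x ≡ x ⦄.

Definition church_zero : term := ⦃ v | ∃ f, v ≡ ⟨f, idset⟩ ∧ f ≡ f ⦄.

(** The value s_z of the Church successor at [z]. *)
Definition church_succ_val (z : term) : term :=
  ⦃ v | ∃ f p, v ≡ ⟨f, p⟩ ∧ f ∈ FUNC ∧
    ∀ u, u ∈ p ⇔
      ∃ x w t q, u ≡ ⟨x, w⟩ ∧ t ∈ FUNC ∧ ⟨f, t⟩ ∈ z ∧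
                 ⟨x, q⟩ ∈ t ∧ ⟨q, w⟩ ∈ f ⦄.

Definition church_succ : term :=
  ⦃ v | ∃ z, v ≡ ⟨z, church_succ_val z⟩ ∧ z ∈ FUNC ⦄.

Definition churchN : term :=
  ⦃ n | ∀ w, church_zero ∈ w ∧ (∀ x, x ∈ w ⇒ Ap church_succ x ∈ w) ⇒ n ∈ w ⦄.

Definition frege_zero : term := sing empty.

Definition frege_succ (x : term) : term :=
  ⦃ v | ∃ u c, v ≡ union u (sing c) ∧ u ∈ x ∧ ¬ (c ∈ u) ⦄.

Definition fregeF : term :=
  ⦃ n | ∀ w,
    frege_zero ∈ w ∧
    (∀ x, x ∈ w ∧ (∃ u, u ∈ frege_succ x) ⇒ frege_succ x ∈ w) ⇒ n ∈ w ⦄.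

(* Main.v *)
From Stdlib Require Import List Lia PeanoNat ClassicalEpsilon.
Require Import Defs.

(** A Church number [n] acts on a relation [f] as the [n]-fold iterate of [f].
    If [f] is an injective function and [a] is outside its range, then [n] is
    determined by the result of iterating [f] from [a]: cancel applications of
    [f] on both sides. So [S x = S y] implies [x = y] as soon as some such [f]
    can be iterated [S x] times from some [a]. Such chains are built inside the
    members of finite cardinals, by induction on [n]: a member of [k^+] is a
    member of [k] with one more point, which is appended to the chain; that
    [k^+] stays in F makes it inhabited. Finally [0] is not a successor, and [S]
    maps [N] onto a proper part of [N].

    The derivation is carried out in a Kripke model whose worlds are contexts
    and in which forcing coincides with provability. *)

(** * Renaming and weakening of derivations *)

(** The statement has no set terms: every abstract is eliminated into atomic contexts, so even a
    claim about pairs becomes a large formula with de Bruijn indices. This is the obstacle that the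
    model removes. A set of the model is a definite description, hence abstracts are actual objects,
    hypotheses become Rocq hypotheses, and equals may be substituted in definable predicates. What
    remains of the weakness of INF is that each induction over [churchN] is an instance of
    comprehension, so its predicate must be stratified. Excluded middle serves only in the
    metatheory, to make [setof] total; the derivation obtained is intuitionistic.

    No map from N to F is constructed: a Church number is merely related to some cardinal whose
    members all carry a long enough chain, which is a stratified condition. The chains are partial
    functions, so iteration is treated as a relation rather than by [Ap]. Membership and equality
    are never decided: the freshness of an added point is part of the Frege successor, and cases are
    split only on membership in a union, on equations from unordered pairs, and on a Church number
    being zero or a successor. *)

Fixpoint bnd (p : form) : nat :=
  match p with
  | Eq x y | Mem x y => S (max x y)
  | Bot => 0
  | And p q | Or p q | Imp p q => max (bnd p) (bnd q)
  | All p | Ex p => pred (bnd p)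
  end.

Lemma ren_ext_bnd p : forall r s,
  (forall i, i < bnd p -> r i = s i) -> ren r p = ren s p.
Proof.
  induction p; cbn; intros r s H;
    try (f_equal; solve [apply H; lia | apply IHp1; intros; apply H; lia
                        | apply IHp2; intros; apply H; lia]).
  - reflexivity.
  - f_equal; apply IHp; intros [|i] Hi; cbn; [reflexivity|]; f_equal; apply H; lia.
  - f_equal; apply IHp; intros [|i] Hi; cbn; [reflexivity|]; f_equal; apply H; lia.
Qed.

Lemma ren_ext p r s : (forall i, r i = s i) -> ren r p = ren s p.
Proof. intros H; apply ren_ext_bnd; auto. Qed.

Lemma ren_ren p : forall r s, ren r (ren s p) = ren (fun i => r (s i)) p.
Proof.
  induction p; cbn; intros r s; f_equal; auto;
    rewrite IHp; apply ren_ext; intros [|i]; reflexivity.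
Qed.

Lemma ren_id p : ren (fun i => i) p = p.
Proof.
  induction p; cbn; f_equal; auto;
    rewrite <- IHp at 2; apply ren_ext; intros [|i]; reflexivity.
Qed.

Lemma ren_inst r t p : ren r (inst t p) = inst (r t) (ren (up r) p).
Proof. unfold inst; rewrite !ren_ren; apply ren_ext; intros [|i]; reflexivity. Qed.

Lemma ren_shift r p : ren (up r) (shift p) = shift (ren r p).
Proof. unfold shift; rewrite !ren_ren; apply ren_ext; intros i; reflexivity. Qed.

Lemma map_ren_shift r G : map (ren (up r)) (map shift G) = map shift (map (ren r) G).
Proof. rewrite !map_map; apply map_ext; intros; apply ren_shift. Qed.

Lemma strat_ren p : forall e e' r,
  (forall i, i < bnd p -> e' (r i) = e i) -> strat e p -> strat e' (ren r p).
Proof.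
  induction p; cbn; intros e e' r H.
  - rewrite !H by lia; auto.
  - rewrite !H by lia; auto.
  - auto.
  - intros [? ?]; split; [apply (IHp1 e)|apply (IHp2 e)]; auto; intros; apply H; lia.
  - intros [? ?]; split; [apply (IHp1 e)|apply (IHp2 e)]; auto; intros; apply H; lia.
  - intros [? ?]; split; [apply (IHp1 e)|apply (IHp2 e)]; auto; intros; apply H; lia.
  - intros [n Hn]; exists n; eapply IHp; [|exact Hn].
    intros [|i] Hi; cbn; [reflexivity|]; apply H; lia.
  - intros [n Hn]; exists n; eapply IHp; [|exact Hn].
    intros [|i] Hi; cbn; [reflexivity|]; apply H; lia.
Qed.

Lemma prv_weaken G G' p : prv INF G p -> incl G G' -> prv INF G' p.
Proof.
  intros H; revert G'; induction H; intros G' HG.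
  - apply Hyp; auto.
  - apply Axm; auto.
  - apply BotE; auto.
  - apply AndI; auto.
  - eapply AndE1; auto.
  - eapply AndE2; auto.
  - apply OrI1; auto.
  - apply OrI2; auto.
  - eapply OrE; [apply IHprv1; auto|apply IHprv2|apply IHprv3];
      intros a [<-|Ha]; cbn; auto.
  - apply ImpI; apply IHprv; intros a [<-|Ha]; cbn; auto.
  - eapply ImpE; [apply IHprv1|apply IHprv2]; auto.
  - apply AllI, IHprv, incl_map, HG.
  - apply AllE; auto.
  - eapply ExI; auto.
  - eapply ExE; [apply IHprv1; auto|apply IHprv2].
    intros a [<-|Ha]; [left; auto|right]. revert a Ha; apply incl_map, HG.
  - apply EqI.
  - eapply EqE; [apply IHprv1|apply IHprv2]; auto.
Qed.

(** Only left-invertible renamings: identifying variables may destroy the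
    stratification of an axiom. *)
Lemma prv_ren G p : prv INF G p ->
  forall r g, (forall i, g (r i) = i) -> prv INF (map (ren r) G) (ren r p).
Proof.
  induction 1; intros ρ g Hg; cbn in *.
  - apply Hyp, in_map, H.
  - destruct H as [|p [e He]].
    + apply Axm; constructor.
    + pose proof (INF_comp (ren (up ρ) p)) as A.
      cbn. rewrite ren_ren.
      replace (ren (fun i => up (up ρ) (up S i)) p) with (ren (up S) (ren (up ρ) p)).
      (* The indices of the parameters are pulled back along the left inverse [g]. *)
      * apply Axm, A. exists (scons (e 0) (fun i => e (S (g i)))).
        eapply strat_ren; [|exact He].
        intros [|i] _; cbn; rewrite ?Hg; reflexivity.
      * rewrite ren_ren; apply ren_ext; intros [|i]; reflexivity.
  - apply BotE; eauto.
  - apply AndI; eauto.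
  - eapply AndE1; eauto.
  - eapply AndE2; eauto.
  - apply OrI1; eauto.
  - apply OrI2; eauto.
  - eapply OrE; eauto.
  - apply ImpI; eauto.
  - eapply ImpE; eauto.
  - apply AllI. rewrite <- map_ren_shift. apply (IHprv _ (up g)).
    intros [|i]; cbn; rewrite ?Hg; reflexivity.
  - rewrite ren_inst. apply AllE; eauto.
  - apply (ExI _ _ _ (ρ t)). rewrite <- ren_inst; eauto.
  - eapply ExE; [eauto|]. rewrite <- map_ren_shift, <- ren_shift. apply (IHprv2 _ (up g)).
    intros [|i]; cbn; rewrite ?Hg; reflexivity.
  - apply EqI.
  - rewrite ren_inst. eapply EqE; [eauto|]. rewrite <- ren_inst; eauto.
Qed.

Definition bnds (G : list form) : nat := list_max (map bnd G).

Lemma bnds_in G p : In p G -> bnd p <= bnds G.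
Proof.
  intros H. pose proof (proj1 (list_max_le (map bnd G) (bnds G)) (le_n _)) as F.
  rewrite Forall_forall in F. apply F, in_map, H.
Qed.

(** [release t] turns the free variable [t] into the variable 0 of a new binder. *)
Definition release (t i : nat) : nat := if Nat.eq_dec i t then 0 else S i.

Lemma release_shift t p : bnd p <= t -> ren (release t) p = shift p.
Proof.
  intros H; apply ren_ext_bnd; intros i Hi; unfold release.
  destruct (Nat.eq_dec i t); [lia|reflexivity].
Qed.

Lemma release_shifts t G : bnds G <= t -> map (ren (release t)) G = map shift G.
Proof.
  intros H; apply map_ext_in; intros p Hp; apply release_shift.
  pose proof (bnds_in G p Hp); lia.
Qed.

Lemma release_inst t p : bnd p <= t -> ren (release t) (inst t p) = p.
Proof.
  intros H; transitivity (ren (fun i => i) p); [|apply ren_id].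
  unfold inst; rewrite ren_ren; apply ren_ext_bnd; intros [|i] Hi; cbn; unfold release.
  - destruct (Nat.eq_dec t t); [reflexivity|lia].
  - destruct (Nat.eq_dec i t); [lia|reflexivity].
Qed.

Lemma prv_release t G p :
  prv INF G p -> prv INF (map (ren (release t)) G) (ren (release t) p).
Proof.
  intros H; apply (prv_ren _ _ H _ (fun i => match i with 0 => t | S j => j end)).
  intros i; unfold release; destruct (Nat.eq_dec i t); auto.
Qed.

(** One instance suffices, at a variable [t] fresh for [G] and [p]: releasing [t] turns its
    derivation into the premise of [AllI]. *)
Lemma prv_all G p : (forall t, prv INF G (inst t p)) -> prv INF G (All p).
Proof.
  intros H. set (t := max (bnds G) (bnd p)). apply AllI.
  rewrite <- (release_shifts t) by lia. rewrite <- (release_inst t p) by lia.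
  apply prv_release, H.
Qed.

Lemma prv_ex G p q :
  prv INF G (Ex p) -> (forall t, prv INF (inst t p :: G) q) -> prv INF G q.
Proof.
  intros Hp H. set (t := max (bnds G) (max (bnd p) (bnd q))).
  eapply ExE; [exact Hp|].
  pose proof (prv_release t _ _ (H t)) as K; cbn in K.
  rewrite release_inst, release_shifts, release_shift in K by lia. exact K.
Qed.

(** A renaming that identifies variables is out of reach of [prv_ren]. Without hypotheses, the first
    [N] variables can instead be quantified one by one and then instantiated; the others move down
    by [N]. *)
Lemma prv_closure N : forall p r,
  prv INF nil p -> (forall i, r (N + i) = i) -> prv INF nil (ren r p).
Proof.
  induction N as [|N IH]; intros p r H Hr.
  - rewrite (ren_ext _ _ (fun i => i)), ren_id; auto.
  - assert (K : prv INF nil (ren (fun i => r (S i)) (All p))).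
    { apply IH; [apply AllI; exact H|intros; apply Hr]. }
    apply (AllE _ _ _ (r 0)) in K. unfold inst in K. rewrite ren_ren in K.
    rewrite (ren_ext _ _ r) in K; [exact K|]. intros [|i]; reflexivity.
Qed.

Lemma prv_subst p r : prv INF nil p -> prv INF nil (ren r p).
Proof.
  intros H.
  (* Values from [bnd p] on do not affect [p]; they are chosen to meet the side condition of
     [prv_closure]. *)
  rewrite (ren_ext_bnd p r (fun i => if i <? bnd p then r i else i - bnd p)).
  - apply (prv_closure (bnd p)); [exact H|]. intros i.
    destruct (Nat.ltb_spec (bnd p + i) (bnd p)); lia.
  - intros i Hi. destruct (Nat.ltb_spec i (bnd p)); lia.
Qed.

Module Model.

(** * Forcing *)

Notation world := (list form).

(** [cov P w]: [w] is covered by the worlds where [P] holds, as far as the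
    provability of formulas can tell. *)
Definition cov (P : world -> Prop) (w : world) : Prop :=
  forall w' q, incl w w' ->
    (forall w'', incl w' w'' -> P w'' -> prv INF w'' q) -> prv INF w' q.

Lemma cov_mono P w w' : incl w w' -> cov P w -> cov P w'.
Proof. intros L H v q L'; apply H; eapply incl_tran; eauto. Qed.

Lemma cov_cov P w : cov (cov P) w -> cov P w.
Proof.
  intros H v q L K. apply H; [exact L|]. intros v' L' H'.
  apply H'; [apply incl_refl|]. intros v'' L''. apply K. eapply incl_tran; eauto.
Qed.

Lemma cov_incl P Q w : (forall w', incl w w' -> P w' -> Q w') -> cov P w -> cov Q w.
Proof.
  intros PQ H v q L K. apply H; [exact L|]. intros v' L' HP.
  apply K; [exact L'|]. apply PQ; [eapply incl_tran; eauto|exact HP].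
Qed.

(** The truth values. Closure under [cov] is what makes disjunction and existence agree with
    provability: a context may prove [Or p q] without proving either side. *)
Record hp := Hp
  { holds : world -> Prop;
    mono : forall w w', incl w w' -> holds w -> holds w';
    cov_holds : forall w, cov holds w -> holds w }.

Declare Scope hp_scope.
Delimit Scope hp_scope with hp.
Bind Scope hp_scope with hp.
Open Scope hp_scope.

Notation "w ⊩ P" := (holds P%hp w) (at level 94, P at level 93, no associativity).

#[local] Obligation Tactic := idtac.

Program Definition lift (p : form) : hp := Hp (fun w => prv INF w p) _ _.
Next Obligation. cbn; intros; eapply prv_weaken; eauto. Qed.
Next Obligation. intros p w H; apply H; auto using incl_refl. Qed.

Program Definition hbot : hp := Hp (cov (fun _ => False)) _ _.
Next Obligation. apply cov_mono. Qed.
Next Obligation. apply cov_cov. Qed.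

Program Definition hand (P Q : hp) : hp := Hp (fun w => holds P w /\ holds Q w) _ _.
Next Obligation. cbn; intros ? ? ? ? ? []; split; eapply mono; eauto. Qed.
Next Obligation.
  intros P Q w H; split; apply cov_holds; revert H; apply cov_incl; cbn; tauto.
Qed.

Program Definition hor (P Q : hp) : hp := Hp (cov (fun w => holds P w \/ holds Q w)) _ _.
Next Obligation. intros P Q; apply cov_mono. Qed.
Next Obligation. intros P Q; apply cov_cov. Qed.

Program Definition himp (P Q : hp) : hp :=
  Hp (fun w => forall w', incl w w' -> holds P w' -> holds Q w') _ _.
Next Obligation. cbn; intros P Q w w' L H v L'; apply H; eapply incl_tran; eauto. Qed.
Next Obligation.
  cbn; intros P Q w H v L HP. apply cov_holds.
  apply (cov_mono _ _ _ L) in H. revert H; apply cov_incl.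
  intros w' L' K. apply K; [apply incl_refl|]. eapply mono; eauto.
Qed.

Program Definition hall {A} (P : A -> hp) : hp := Hp (fun w => forall x, holds (P x) w) _ _.
Next Obligation. cbn; intros; eapply mono; eauto. Qed.
Next Obligation.
  cbn; intros A P w H x; apply cov_holds; revert H; apply cov_incl; auto.
Qed.

Program Definition hex {A} (P : A -> hp) : hp := Hp (cov (fun w => exists x, holds (P x) w)) _ _.
Next Obligation. intros A P; apply cov_mono. Qed.
Next Obligation. intros A P; apply cov_cov. Qed.

Definition hiff (P Q : hp) : hp := hand (himp P Q) (himp Q P).

Notation "¬ p" := (himp p hbot) (at level 75, right associativity) : hp_scope.
Notation "p ∧ q" := (hand p q) (at level 80, right associativity) : hp_scope.
Notation "p ∨ q" := (hor p q) (at level 85, right associativity) : hp_scope.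
Notation "p ⇒ q" := (himp p q) (at level 90, right associativity) : hp_scope.
Notation "p ⇔ q" := (hiff p q) (at level 95, no associativity) : hp_scope.
Notation "∀ x .. y , p" := (hall (fun x => .. (hall (fun y => p%hp)) ..))
  (at level 200, x binder, y binder, right associativity) : hp_scope.
Notation "∃ x .. y , p" := (hex (fun x => .. (hex (fun y => p%hp)) ..))
  (at level 200, x binder, y binder, right associativity) : hp_scope.

Lemma cov_intro (P : world -> Prop) w :
  (forall w', incl w w' -> P w -> P w') -> P w -> cov P w.
Proof. intros M H w' q L K; apply K; auto using incl_refl. Qed.

Lemma cov_elim (P : world -> Prop) (R : hp) w :
  cov P w -> (forall w', incl w w' -> P w' -> w' ⊩ R) -> w ⊩ R.
Proof. intros H K; apply cov_holds; revert H; apply cov_incl, K. Qed.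

Lemma bot_elim w R : w ⊩ hbot -> w ⊩ R.
Proof. intros H; apply (cov_elim _ _ _ H); tauto. Qed.

Lemma or_introl' w P Q : w ⊩ P -> w ⊩ P ∨ Q.
Proof. intros H; apply cov_intro; auto. intros w' L [K|K]; eauto using mono. Qed.

Lemma or_intror' w P Q : w ⊩ Q -> w ⊩ P ∨ Q.
Proof. intros H; apply cov_intro; auto. intros w' L [K|K]; eauto using mono. Qed.

Lemma or_elim w P Q R : w ⊩ P ∨ Q ->
  (forall w', incl w w' -> w' ⊩ P -> w' ⊩ R) ->
  (forall w', incl w w' -> w' ⊩ Q -> w' ⊩ R) -> w ⊩ R.
Proof. intros H H1 H2; apply (cov_elim _ _ _ H); intros w' L [K|K]; auto. Qed.

Lemma ex_intro' {A} w (P : A -> hp) x : w ⊩ P x -> w ⊩ hex P.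
Proof.
  intros H; apply cov_intro; eauto. intros w' L [y K]; exists y; eapply mono; eauto.
Qed.

Lemma ex_elim {A} w (P : A -> hp) R : w ⊩ hex P ->
  (forall w' x, incl w w' -> w' ⊩ P x -> w' ⊩ R) -> w ⊩ R.
Proof. intros H K; apply (cov_elim _ _ _ H); intros w' L [x Hx]; eauto. Qed.

Lemma mp w P Q : w ⊩ P ⇒ Q -> w ⊩ P -> w ⊩ Q.
Proof. intros H; apply H, incl_refl. Qed.

Lemma iff1 w P Q : w ⊩ (P ⇔ Q) -> w ⊩ P -> w ⊩ Q.
Proof. intros [H _]; apply mp, H. Qed.

Lemma iff2 w P Q : w ⊩ (P ⇔ Q) -> w ⊩ Q -> w ⊩ P.
Proof. intros [_ H]; apply mp, H. Qed.

(** [advance L], for [L : incl w w'], moves the facts forced at [w] to [w'],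
    which takes over the name [w]. *)
Ltac advance L :=
  match type of L with incl ?w ?w' =>
    repeat match goal with H : holds ?P w |- _ => apply (mono P _ _ L) in H end;
    clear L; clear w; rename w' into w
  end.

Tactic Notation "adv" :=
  let v := fresh "v" in let L := fresh "L" in intros v L; advance L.
Tactic Notation "himp" ident(H) := adv; intros H.
Tactic Notation "hsplit" := split; adv.
Tactic Notation "hleft" := apply or_introl'.
Tactic Notation "hright" := apply or_intror'.
Tactic Notation "hexists" constr(x) := apply (ex_intro' _ _ x).
Tactic Notation "hdes" constr(H) "as" ident(x) simple_intropattern(p) :=
  apply (ex_elim _ _ _ H); clear H;
  let v := fresh "v" in let L := fresh "L" in
  intros v x L; advance L; intros p.
Tactic Notation "hcase" constr(H) "as" simple_intropattern(p) :=
  apply (or_elim _ _ _ _ H); clear H; adv; intros p.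

(** * Sets of the model as definite descriptions *)

Lemma prv_eq_sym w x y : prv INF w (Eq x y) -> prv INF w (Eq y x).
Proof. intros H; apply (EqE _ _ (Eq 0 (S x)) _ _ H); apply EqI. Qed.

Lemma prv_eq_trans w x y z : prv INF w (Eq x y) -> prv INF w (Eq y z) -> prv INF w (Eq x z).
Proof. intros H K; exact (EqE _ _ (Eq (S x) 0) _ _ K H). Qed.

Lemma prv_mem_eq w x y x' y' : prv INF w (Eq x x') -> prv INF w (Eq y y') ->
  prv INF w (Mem x y) -> prv INF w (Mem x' y').
Proof.
  intros H K M. apply (EqE _ _ (Mem 0 (S y'))  _ _ H).
  exact (EqE _ _ (Mem (S x) 0)  _ _ K M).
Qed.

(** Sets of the model are definite descriptions, so that provably unique
    existence yields an element of the model. *)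
Record set := Set_
  { den : nat -> hp;
    den_ex : forall w, w ⊩ hex den;
    den_uniq : forall w x y, w ⊩ den x -> w ⊩ den y -> prv INF w (Eq x y);
    den_eq : forall w x y, w ⊩ den x -> prv INF w (Eq x y) -> w ⊩ den y }.

Program Definition name (v : nat) : set := Set_ (fun x => lift (Eq v x)) _ _ _.
Next Obligation. intros v w; hexists v; apply EqI. Qed.
Next Obligation. cbn; intros; eauto using prv_eq_sym, prv_eq_trans. Qed.
Next Obligation. cbn; intros; eauto using prv_eq_trans. Qed.

Definition hmem (X Y : set) : hp := ∀ x y : nat, den X x ⇒ den Y y ⇒ lift (Mem x y).
(** One inclusion is enough, as descriptions have exactly one solution up to provable equality. *)
Definition heq (X Y : set) : hp := ∀ x : nat, den X x ⇒ den Y x.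

Notation "s ∈ t" := (hmem s t) (at level 70, no associativity) : hp_scope.
Notation "s ≡ t" := (heq s t) (at level 70, no associativity) : hp_scope.

Lemma heq_refl w X : w ⊩ X ≡ X.
Proof. intros x. himp H; exact H. Qed.

Lemma heq_sym w X Y : w ⊩ X ≡ Y -> w ⊩ Y ≡ X.
Proof.
  intros H x. himp Hx.
  pose proof (den_ex X w) as K. hdes K as y Hy.
  pose proof (mp _ _ _ (H y) Hy) as K. eapply den_eq; [exact Hy|].
  eapply den_uniq; eauto.
Qed.

Lemma heq_trans w X Y Z : w ⊩ X ≡ Y -> w ⊩ Y ≡ Z -> w ⊩ X ≡ Z.
Proof. intros H K x. himp Hx. exact (mp _ _ _ (K x) (mp _ _ _ (H x) Hx)). Qed.

Lemma hmem_eq w X Y X' Y' : w ⊩ X ≡ X' -> w ⊩ Y ≡ Y' -> w ⊩ X ∈ Y -> w ⊩ X' ∈ Y'.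
Proof.
  intros H K M x y. himp Hx. himp Hy.
  apply heq_sym in H, K.
  exact (mp _ _ _ (mp _ _ _ (M x y) (mp _ _ _ (H x) Hx)) (mp _ _ _ (K y) Hy)).
Qed.

Lemma name_den w X x : w ⊩ den X x -> w ⊩ X ≡ name x.
Proof. intros H y. himp Hy. eapply den_uniq; eauto. Qed.

(** Reduces claims about sets to claims about variables: a description may have no solution at [w]
    itself, but it has one throughout a cover of [w]. *)
Lemma set_named w X R :
  (forall w' x, incl w w' -> w' ⊩ X ≡ name x -> w' ⊩ R) -> w ⊩ R.
Proof.
  intros H; apply (ex_elim _ _ _ (den_ex X w)); intros w' x L Hx.
  eapply H; [exact L|apply name_den, Hx].
Qed.

Tactic Notation "named" constr(X) ident(x) ident(H) :=
  apply (set_named _ X);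
  let v := fresh "v" in let L := fresh "L" in intros v x L H; advance L.

Lemma mem_name w x y : w ⊩ name x ∈ name y <-> prv INF w (Mem x y).
Proof.
  split.
  - intros H. exact (mp _ _ _ (mp _ _ _ (H x y) (EqI _ _ _)) (EqI _ _ _)).
  - intros H x' y'. assert (K : w ⊩ lift (Mem x y)) by exact H.
    clear H. himp Hx. himp Hy. cbn in *. eapply prv_mem_eq; eauto.
Qed.

Lemma eq_name w x y : w ⊩ name x ≡ name y <-> prv INF w (Eq x y).
Proof.
  split.
  - intros H. apply prv_eq_sym. exact (mp _ _ _ (H x) (EqI _ _ _)).
  - intros H z. assert (K : w ⊩ lift (Eq x y)) by exact H.
    clear H. himp Hx. cbn in *. eauto using prv_eq_sym, prv_eq_trans.
Qed.

(** * Interpretation of formulas and transfer of the axioms *)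

Definition vcons {A} (a : A) (r : nat -> A) (i : nat) : A :=
  match i with 0 => a | S j => r j end.

Fixpoint sem (p : form) (r : nat -> set) : hp :=
  match p with
  | Eq x y => r x ≡ r y
  | Mem x y => r x ∈ r y
  | Bot => hbot
  | And p q => sem p r ∧ sem q r
  | Or p q => sem p r ∨ sem q r
  | Imp p q => sem p r ⇒ sem q r
  | All p => ∀ X, sem p (vcons X r)
  | Ex p => ∃ X, sem p (vcons X r)
  end.

Lemma sem_cong p : forall r s w,
  (forall i, i < bnd p -> w ⊩ r i ≡ s i) -> w ⊩ sem p r -> w ⊩ sem p s.
Proof.
  induction p; cbn -[holds heq hmem hand hor himp hall hex]; intros r s w H.
  - intros K. eapply heq_trans; [apply heq_sym, H; lia|].
    eapply heq_trans; [exact K|apply H; lia].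
  - apply hmem_eq; apply H; lia.
  - auto.
  - intros [H1 H2]; split; [eapply IHp1|eapply IHp2]; eauto; intros; apply H; lia.
  - intros K; apply (or_elim _ _ _ _ K); intros w' L K';
      [hleft; eapply IHp1|hright; eapply IHp2]; eauto;
      intros; apply (mono _ _ _ L), H; lia.
  - intros K w' L K'. eapply IHp2; [|apply K; [exact L|]; eapply IHp1; [|exact K']].
    + intros; eapply mono; [exact L|]; apply H; lia.
    + intros; eapply mono; [exact L|]; apply heq_sym, H; lia.
  - intros K X. eapply IHp; [|apply (K X)].
    intros [|i] Hi; cbn -[holds heq]; [apply heq_refl|apply H; lia].
  - intros K. apply (ex_elim _ _ _ K); intros w' X L K'. hexists X.
    eapply IHp; [|exact K'].
    intros [|i] Hi; cbn -[holds heq]; [apply heq_refl|].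
    eapply mono; [exact L|]; apply H; lia.
Qed.

Lemma sem_ext p r s w : (forall i, r i = s i) -> w ⊩ sem p r -> w ⊩ sem p s.
Proof. intros H; apply sem_cong; intros i _; rewrite H; apply heq_refl. Qed.

Lemma sem_ren p : forall f r w, w ⊩ sem (ren f p) r <-> w ⊩ sem p (fun i => r (f i)).
Proof.
  assert (E : forall q X f (r : nat -> set) w,
    w ⊩ sem q (fun i => vcons X r (up f i)) <-> w ⊩ sem q (vcons X (fun i => r (f i)))).
  { intros; split; apply sem_ext; intros [|i]; reflexivity. }
  induction p; cbn -[holds heq hmem hand hor himp hall hex]; intros f r w; try tauto.
  - split; intros [? ?]; split; try apply IHp1; try apply IHp2; auto.
  - split; intros K; apply (or_elim _ _ _ _ K); intros w' L K';
      try (hleft; apply IHp1; exact K'); hright; apply IHp2; exact K'.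
  - split; intros K w' L K'; apply IHp2, K, IHp1, K'; exact L.
  - split; intros K X; [apply E, IHp, K|apply IHp, E, K].
  - split; intros K; apply (ex_elim _ _ _ K); intros w' X L K'; hexists X;
      [apply E, IHp, K'|apply IHp, E, K'].
Qed.

(** The truth lemma. Implication moves to the world extended by the antecedent, the universal
    quantifier to a fresh variable via [prv_all]; for [Or] and [Ex], a cover matches the elimination
    rule, whose goal [q] is arbitrary. *)
Lemma sem_name p : forall r w,
  w ⊩ sem p (fun i => name (r i)) <-> prv INF w (ren r p).
Proof.
  assert (E : forall q x r w,
    w ⊩ sem q (vcons (name x) (fun i => name (r i))) <->
    w ⊩ sem q (fun i => name (scons x r i))).
  { intros; split; apply sem_ext; intros [|i]; reflexivity. }
  assert (I : forall q x r, inst x (ren (up r) q) = ren (scons x r) q).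
  { intros; unfold inst; rewrite ren_ren; apply ren_ext; intros [|i]; reflexivity. }
  induction p; cbn -[holds heq hmem hand hor himp hall hex]; intros r w.
  - apply eq_name.
  - apply mem_name.
  - split.
    + intros H; apply (bot_elim w (lift Bot) H).
    + intros H w' q L _. apply BotE. eapply prv_weaken; eauto.
  - split; [intros [? ?]; apply AndI; [apply IHp1|apply IHp2]; auto|].
    intros H; split; [apply IHp1; eapply AndE1|apply IHp2; eapply AndE2]; eauto.
  - split.
    + intros K; apply (or_elim _ _ _ (lift (Or (ren r p1) (ren r p2))) K); intros w' L K'; cbn;
        [apply OrI1, IHp1, K'|apply OrI2, IHp2, K'].
    + intros H w' q L K. eapply OrE; [eapply prv_weaken; eauto| |].
      * apply K; [apply incl_tl, incl_refl|left; apply IHp1, Hyp; left; auto].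
      * apply K; [apply incl_tl, incl_refl|right; apply IHp2, Hyp; left; auto].
  - split.
    + intros K. apply ImpI, IHp2, K; [apply incl_tl, incl_refl|].
      apply IHp1, Hyp; left; auto.
    + intros H w' L K. apply IHp2. eapply ImpE; [eapply prv_weaken; eauto|].
      apply IHp1, K.
  - split.
    + intros K. apply prv_all; intros x. rewrite I. apply IHp, E, K.
    + intros H X. assert (K : w ⊩ lift (All (ren (up r) p))) by exact H. clear H.
      named X x Hx. cbn in K. apply (AllE _ _ _ x) in K. rewrite I in K.
      apply IHp, E in K. revert K; apply sem_cong.
      intros [|i] _; cbn -[holds heq]; [apply heq_sym, Hx|apply heq_refl].
  - split.
    + intros K. apply (ex_elim _ _ (lift (Ex (ren (up r) p))) K); intros w' X L K'.
      clear K L. named X x Hx. cbn. apply (ExI _ _ _ x). rewrite I. apply IHp, E.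
      revert K'; apply sem_cong.
      intros [|i] _; cbn -[holds heq]; [apply Hx|apply heq_refl].
    + intros H w' q L K. eapply prv_ex; [eapply prv_weaken; eauto|].
      intros x. apply K; [apply incl_tl, incl_refl|]. exists (name x).
      apply E, IHp. rewrite <- I. apply Hyp; left; auto.
Qed.

Lemma all_named w (r : nat -> set) N R :
  (forall w' s, incl w w' -> (forall i, i < N -> w' ⊩ r i ≡ name (s i)) -> w' ⊩ R) -> w ⊩ R.
Proof.
  revert w r; induction N as [|N IH]; intros w r H.
  - apply (H w (fun i => i)); [apply incl_refl|lia].
  - apply (set_named _ (r 0)); intros w1 x L1 Hx.
    apply (IH w1 (fun i => r (S i))); intros w2 s L2 Hs.
    apply (H w2 (scons x s)); [eapply incl_tran; eauto|].
    intros [|i] Hi; cbn -[holds heq]; [eapply mono; eauto|apply Hs; lia].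
Qed.

(** The axiom speaks of variables only; naming its finitely many parameters brings arbitrary sets
    within the scope of [sem_name]. *)
Lemma comprehension p r w : stratified p ->
  w ⊩ (∃ A, ∀ X, X ∈ A ⇔ sem p (vcons X r)).
Proof.
  intros Hp.
  set (q := Ex (All (Iff (Mem 0 1) (ren (up S) p)))).
  assert (K : w ⊩ sem q r).
  { apply (all_named w r (bnd q)); intros w' s L Hs.
    apply (sem_cong _ (fun i => name (s i))).
    - intros i Hi; apply heq_sym, Hs, Hi.
    (* The names [s i] may coincide, so the axiom is instantiated in the empty context by
       [prv_subst]. *)
    - apply sem_name. eapply prv_weaken; [|apply incl_nil_l].
      apply prv_subst, Axm; constructor; exact Hp. }
  cbn -[holds heq hmem hand hor himp hall hex] in K.
  hdes K as A HA. hexists A. intros X. destruct (HA X) as [H1 H2].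
  assert (E : forall w, w ⊩ sem (ren (up S) p) (vcons X (vcons A r)) <->
                        w ⊩ sem p (vcons X r)).
  { intros v; rewrite sem_ren; split; apply sem_ext; intros [|i]; reflexivity. }
  split; intros w' L' M; [apply E, H1|apply H2, E]; assumption.
Qed.

Lemma extensionality w A B : w ⊩ (∀ X, X ∈ A ⇔ X ∈ B) -> w ⊩ A ≡ B.
Proof.
  intros H. named A a Ha. named B b Hb.
  assert (Q : w ⊩ name a ≡ name b).
  { apply eq_name.
    assert (X : prv INF w (All (All (Imp (All (Iff (Mem 0 2) (Mem 0 1))) (Eq 1 0))))).
    { apply Axm; constructor. }
    apply (AllE _ _ _ a) in X. apply (AllE _ _ _ b) in X. cbn in X.
    eapply ImpE; [exact X|]. clear X.
    apply prv_all; intros x. cbn.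
    destruct (H (name x)) as [H1 H2].
    apply AndI; apply ImpI.
    - set (v := Mem x a :: w) in *.
      assert (L : incl w v) by apply incl_tl, incl_refl.
      apply mem_name. eapply hmem_eq; [apply heq_refl|eapply mono; [exact L|exact Hb]|].
      apply H1; [exact L|].
      eapply hmem_eq; [apply heq_refl|eapply mono; [exact L|apply heq_sym, Ha]|].
      apply mem_name, Hyp; left; auto.
    - set (v := Mem x b :: w) in *.
      assert (L : incl w v) by apply incl_tl, incl_refl.
      apply mem_name. eapply hmem_eq; [apply heq_refl|eapply mono; [exact L|exact Ha]|].
      apply H2; [exact L|].
      eapply hmem_eq; [apply heq_refl|eapply mono; [exact L|apply heq_sym, Hb]|].
      apply mem_name, Hyp; left; auto. }
  eapply heq_trans; [exact Ha|]. eapply heq_trans; [exact Q|]. apply heq_sym, Hb.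
Qed.

(** * Abstracts as elements of the model *)

Definition definable (F : set -> hp) : Prop :=
  exists p r, stratified p /\ forall X w, w ⊩ F X <-> w ⊩ sem p (vcons X r).

Lemma definable_cong F w X Y : definable F -> w ⊩ X ≡ Y -> w ⊩ F X -> w ⊩ F Y.
Proof.
  intros (p & r & _ & E) H K. apply E. apply E in K. revert K. apply sem_cong.
  intros [|i] _; [exact H|apply heq_refl].
Qed.

Program Definition compr (F : set -> hp) (D : definable F) : set :=
  Set_ (fun a => ∀ X, X ∈ name a ⇔ F X) _ _ _.
Next Obligation.
  intros F (p & r & S & E) w. pose proof (comprehension p r w S) as K.
  hdes K as A HA. named A a Ha. hexists a. intros X. destruct (HA X) as [H1 H2].
  hsplit; intros M.
  - apply E. apply (mp _ _ _ H1). eapply hmem_eq; [apply heq_refl|apply heq_sym, Ha|exact M].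
  - eapply hmem_eq; [apply heq_refl|exact Ha|]. apply (mp _ _ _ H2), E, M.
Qed.
Next Obligation.
  intros F D w x y Hx Hy. apply eq_name, extensionality. intros X.
  destruct (Hx X), (Hy X). hsplit; intros M; eauto using mp.
Qed.
Next Obligation.
  intros F D w x y Hx E X. apply eq_name in E. destruct (Hx X). hsplit; intros M.
  - apply (mp _ _ _ H). eapply hmem_eq; [apply heq_refl|apply heq_sym, E|exact M].
  - eapply hmem_eq; [apply heq_refl|exact E|]. eauto using mp.
Qed.

(** Junk value [name 0] when [F] is not definable. *)
Definition setof (F : set -> hp) : set :=
  match excluded_middle_informative (definable F) with
  | left D => compr F D
  | right _ => name 0
  end.

Notation "⦃ x | p ⦄" := (setof (fun x => p%hp)) (x name) : hp_scope.

Lemma in_setof F w X : definable F -> w ⊩ X ∈ setof F <-> w ⊩ F X.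
Proof.
  intros D. unfold setof. destruct (excluded_middle_informative _) as [D'|]; [|tauto].
  clear D. split; intros M.
  - pose proof (den_ex (compr F D') w) as K. hdes K as a Ha.
    apply (mp _ _ _ (proj1 (Ha X))).
    eapply hmem_eq; [apply heq_refl|apply name_den, Ha|exact M].
  - pose proof (den_ex (compr F D') w) as K. hdes K as a Ha.
    eapply hmem_eq; [apply heq_refl|apply heq_sym, name_den, Ha|].
    apply (mp _ _ _ (proj2 (Ha X)) M).
Qed.

Lemma setof_intro F w X : definable F -> w ⊩ F X -> w ⊩ X ∈ setof F.
Proof. intros D; apply (in_setof _ _ _ D). Qed.

Lemma setof_elim F w X : definable F -> w ⊩ X ∈ setof F -> w ⊩ F X.
Proof. intros D; apply (in_setof _ _ _ D). Qed.

(** * Definability by stratified formulas with parameters *)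

(** Even variables are the bound ones, odd variables the parameters. *)
Definition mix {A} (f g : nat -> A) (i : nat) : A :=
  if Nat.even i then f (Nat.div2 i) else g (Nat.div2 i).

Definition tl {A} (r : nat -> A) (i : nat) : A := r (S i).

Lemma mix_even {A} (f g : nat -> A) i : mix f g (2 * i) = f i.
Proof. unfold mix. rewrite Nat.even_even, Nat.div2_double. reflexivity. Qed.

Lemma mix_odd {A} (f g : nat -> A) i : mix f g (S (2 * i)) = g i.
Proof.
  unfold mix. rewrite Nat.even_succ, Nat.odd_even, Nat.div2_succ_double. reflexivity.
Qed.

Lemma even_odd_cases (P : nat -> Prop) :
  (forall i, P (2 * i)) -> (forall i, P (S (2 * i))) -> forall i, P i.
Proof.
  intros H K i. destruct (Nat.Even_or_Odd i) as [[j ->]|[j ->]]; [apply H|].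
  rewrite Nat.add_1_r; apply K.
Qed.

(** [Def e P]: the predicate [P] of the bound variables is given by a
    formula stratified by [e] on the bound variables. As every occurrence of a
    parameter counts as a new variable, parameters are not constrained. *)
Definition Def (e : nat -> nat) (P : (nat -> set) -> hp) : Prop :=
  exists p s es, strat (mix e es) p /\
    forall r w, w ⊩ P r <-> w ⊩ sem p (mix r s).

(** A term of index [n] is represented by its graph, with the value as variable 0, so no syntax of
    terms is needed. *)
Definition DefT (e : nat -> nat) (n : nat) (X : (nat -> set) -> set) : Prop :=
  Def (vcons n e) (fun r => r 0 ≡ X (tl r)).

Lemma Def_equiv e P Q : (forall r w, w ⊩ P r <-> w ⊩ Q r) -> Def e P -> Def e Q.
Proof.
  intros H (p & s & es & S & E). exists p, s, es; split; [exact S|].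
  intros; rewrite <- H; apply E.
Qed.

Lemma definable_Def n e F r :
  Def (vcons n e) (fun r => F (tl r) (r 0)) -> definable (F r).
Proof.
  (* Place 0 is reserved for the comprehension variable; [r 0] is a filler that the shift
     discards. *)
  intros (p & s & es & S & E). exists p, (fun i => mix (vcons (r 0) r) s (Datatypes.S i)).
  split; [eexists; exact S|]. intros X w. change (F r X) with (F (tl (vcons X r)) X).
  rewrite (E (vcons X r) w). split; apply sem_ext; intros [|i]; try reflexivity;
  cbn; pattern i; apply even_odd_cases; intros j;
  rewrite ?mix_odd; try reflexivity;
  replace (Datatypes.S (Datatypes.S (2 * j))) with (2 * Datatypes.S j) by lia;
  rewrite !mix_even; reflexivity.
Qed.

Definition map_even (f : nat -> nat) (i : nat) : nat :=
  if Nat.even i then 2 * f (Nat.div2 i) else i.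
Definition map_odd (f : nat -> nat) (i : nat) : nat :=
  if Nat.even i then i else S (2 * f (Nat.div2 i)).

Lemma mix_map_even {A} (f : nat -> nat) (r s : nat -> A) i :
  mix r s (map_even f i) = mix (fun i => r (f i)) s i.
Proof.
  unfold map_even. pattern i; apply even_odd_cases; clear i; intros i.
  - rewrite Nat.even_even, Nat.div2_double, !mix_even. reflexivity.
  - rewrite Nat.even_succ, Nat.odd_even, !mix_odd. reflexivity.
Qed.

Lemma mix_map_odd {A} (f : nat -> nat) (r s : nat -> A) i :
  mix r s (map_odd f i) = mix r (fun i => s (f i)) i.
Proof.
  unfold map_odd. pattern i; apply even_odd_cases; clear i; intros i.
  - rewrite Nat.even_even, !mix_even. reflexivity.
  - rewrite Nat.even_succ, Nat.odd_even, Nat.div2_succ_double, !mix_odd. reflexivity.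
Qed.

Lemma Def_ren f e e' P : (forall i, e' (f i) = e i) ->
  Def e P -> Def e' (fun r => P (fun i => r (f i))).
Proof.
  intros H (p & s & es & S & E). exists (ren (map_even f) p), s, es; split.
  - eapply strat_ren; [|exact S]. intros i _. rewrite mix_map_even.
    unfold mix; rewrite H; reflexivity.
  - intros r w. rewrite E, sem_ren. split; apply sem_ext; intros i;
      rewrite mix_map_even; reflexivity.
Qed.

(** The two parameter lists are interleaved into one, so their indices cannot conflict. *)
Lemma Def_join e P Q : Def e P -> Def e Q ->
  exists p q s es, strat (mix e es) p /\ strat (mix e es) q /\
    (forall r w, w ⊩ P r <-> w ⊩ sem p (mix r s)) /\
    (forall r w, w ⊩ Q r <-> w ⊩ sem q (mix r s)).
Proof.
  intros (p & s & es & S & E) (p' & s' & es' & S' & E').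
  set (f i := 2 * i). set (f' i := Datatypes.S (2 * i)).
  exists (ren (map_odd f) p), (ren (map_odd f') p'), (mix s s'), (mix es es').
  assert (M : forall A (r a b : nat -> A) i, mix r (mix a b) (map_odd f i) = mix r a i).
  { intros; rewrite mix_map_odd; unfold mix at 1 3, f; rewrite mix_even; reflexivity. }
  assert (M' : forall A (r a b : nat -> A) i, mix r (mix a b) (map_odd f' i) = mix r b i).
  { intros; rewrite mix_map_odd; unfold mix at 1 3, f'; rewrite mix_odd; reflexivity. }
  repeat match goal with |- _ /\ _ => split end.
  - eapply strat_ren; [|exact S]; intros; apply M.
  - eapply strat_ren; [|exact S']; intros; apply M'.
  - intros r w; rewrite E, sem_ren; split; apply sem_ext; intros; rewrite M; reflexivity.
  - intros r w; rewrite E', sem_ren; split; apply sem_ext; intros; rewrite M'; reflexivity.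
Qed.

Lemma Def_bot e : Def e (fun _ => hbot).
Proof. exists Bot, (fun _ => name 0), e; split; [exact I|]. intros; reflexivity. Qed.

Lemma Def_and e P Q : Def e P -> Def e Q -> Def e (fun r => P r ∧ Q r).
Proof.
  intros H K. destruct (Def_join _ _ _ H K) as (p & q & s & es & S & S' & E & E').
  exists (And p q), s, es; split; [split; assumption|]. intros r w; cbn.
  rewrite E, E'; reflexivity.
Qed.

Lemma Def_or e P Q : Def e P -> Def e Q -> Def e (fun r => P r ∨ Q r).
Proof.
  intros H K. destruct (Def_join _ _ _ H K) as (p & q & s & es & S & S' & E & E').
  exists (Or p q), s, es; split; [split; assumption|]. intros r w; cbn -[holds hor].
  split; intros M; apply (or_elim _ _ _ _ M); intros w' L M'.
  1, 3: hleft; apply E; exact M'. all: hright; apply E'; exact M'.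
Qed.

Lemma Def_imp e P Q : Def e P -> Def e Q -> Def e (fun r => P r ⇒ Q r).
Proof.
  intros H K. destruct (Def_join _ _ _ H K) as (p & q & s & es & S & S' & E & E').
  exists (Imp p q), s, es; split; [split; assumption|]. intros r w; cbn -[holds himp].
  split; intros M w' L M'; apply E', M, E, M'; exact L.
Qed.

Lemma Def_iff e P Q : Def e P -> Def e Q -> Def e (fun r => P r ⇔ Q r).
Proof. intros; apply Def_and; apply Def_imp; assumption. Qed.

(** Moves the newest bound variable in front of the interleaving of all the others, where a de
    Bruijn binder expects it. *)
Definition bind_even (i : nat) : nat := if Nat.even i then pred i else S i.

Lemma mix_bind_even {A} (x : A) r s i :
  vcons x (mix r s) (bind_even i) = mix (vcons x r) s i.
Proof.
  unfold bind_even. pattern i; apply even_odd_cases; clear i; intros i.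
  - rewrite Nat.even_even, mix_even. destruct i; [reflexivity|].
    replace (pred (2 * S i)) with (S (2 * i)) by lia. cbn [vcons]. apply mix_even.
  - rewrite Nat.even_succ, Nat.odd_even, mix_odd. cbn [vcons]. apply mix_odd.
Qed.

Lemma Def_bind n e (P : (nat -> set) -> set -> hp) :
  Def (vcons n e) (fun r => P (tl r) (r 0)) ->
  exists p s es, (exists n, strat (vcons n (mix e es)) p) /\
    forall X r w, w ⊩ P r X <-> w ⊩ sem p (vcons X (mix r s)).
Proof.
  intros (p & s & es & S & E). exists (ren bind_even p), s, es; split.
  - exists n. eapply strat_ren; [|exact S]. intros; apply mix_bind_even.
  - intros X r w. change (P r X) with (P (tl (vcons X r)) X).
    rewrite (E (vcons X r) w), sem_ren.
    split; apply sem_ext; intros; rewrite mix_bind_even; reflexivity.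
Qed.

Lemma Def_all n e (P : (nat -> set) -> set -> hp) :
  Def (vcons n e) (fun r => P (tl r) (r 0)) -> Def e (fun r => ∀ X, P r X).
Proof.
  intros H. destruct (Def_bind _ _ _ H) as (p & s & es & [m S] & E).
  exists (All p), s, es; split; [exists m; exact S|].
  intros r w; split; intros K X; apply E, K.
Qed.

Lemma Def_ex n e (P : (nat -> set) -> set -> hp) :
  Def (vcons n e) (fun r => P (tl r) (r 0)) -> Def e (fun r => ∃ X, P r X).
Proof.
  intros H. destruct (Def_bind _ _ _ H) as (p & s & es & [m S] & E).
  exists (Ex p), s, es; split; [exists m; exact S|].
  intros r w; split; intros K; apply (ex_elim _ _ _ K); intros w' X L K';
    hexists X; apply E, K'.
Qed.

Lemma DefT_var e n i : e i = n -> DefT e n (fun r => r i).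
Proof.
  intros <-. exists (Eq 0 (2 * S i)), (fun _ => name 0), e; split.
  - cbn [strat]. rewrite mix_even. reflexivity.
  - intros r w. cbn [sem]. rewrite mix_even. reflexivity.
Qed.

Lemma DefT_const e n X : DefT e n (fun _ => X).
Proof.
  exists (Eq 0 1), (fun _ => X), (fun _ => n); split; [reflexivity|]. intros; reflexivity.
Qed.

Lemma DefT_tl m e n X : DefT e n X -> DefT (vcons m e) n (fun r => X (tl r)).
Proof.
  intros H.
  apply (Def_ren (fun i => match i with 0 => 0 | S j => S (S j) end) _
           (vcons n (vcons m e))) in H; [exact H|].
  intros [|i]; reflexivity.
Qed.

Lemma Def_mem e n X Y : DefT e n X -> DefT e (S n) Y -> Def e (fun r => X r ∈ Y r).
Proof.
  intros HX HY. apply (Def_equiv _ (fun r => ∃ x, ∃ y, y ≡ Y r ∧ x ≡ X r ∧ x ∈ y)).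
  - intros r w; split.
    + intros K. hdes K as x K. hdes K as y (K1 & K2 & K3). eapply hmem_eq; eauto.
    + intros K. hexists (X r). hexists (Y r). repeat split; auto using heq_refl.
  - apply (Def_ex n). apply (Def_ex (S n)). apply Def_and.
    + apply (DefT_tl n) in HY. exact HY.
    + apply Def_and.
      * apply (Def_ren (fun i => match i with 0 => 1 | S j => S (S j) end) _
           (vcons (S n) (vcons n e))) in HX; [exact HX|].
        intros [|i]; reflexivity.
      (* [y] is bound variable 0, at place 0 of the interleaving; [x] is bound variable 1, at place
         2. *)
      * exists (Mem 2 0), (fun _ => name 0), (fun _ => 0); split; [reflexivity|].
        intros; reflexivity.
Qed.

Lemma Def_eq e n X Y : DefT e n X -> DefT e n Y -> Def e (fun r => X r ≡ Y r).
Proof.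
  intros HX HY. apply (Def_equiv _ (fun r => ∃ x, x ≡ X r ∧ x ≡ Y r)).
  - intros r w; split.
    + intros K. hdes K as x (K1 & K2). eauto using heq_trans, heq_sym.
    + intros K. hexists (X r). split; auto using heq_refl.
  - apply (Def_ex n). apply Def_and; assumption.
Qed.

(** By extensionality, the graph of an abstract is a formula about its elements. *)
Lemma DefT_setof n e F :
  Def (vcons n e) (fun r => F (tl r) (r 0)) -> DefT e (S n) (fun r => setof (F r)).
Proof.
  intros H.
  apply (Def_equiv _ (fun r => ∀ X, X ∈ r 0 ⇔ F (tl r) X)).
  - intros r w. assert (D : definable (F (tl r))) by (eapply definable_Def, H). split.
    + intros K. apply extensionality. intros X. destruct (K X) as [K1 K2].
      hsplit; intros M.
      * apply setof_intro; [exact D|]. exact (mp _ _ _ K1 M).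
      * apply (mp _ _ _ K2). apply setof_elim in M; auto.
    + intros K X. hsplit; intros M.
      * apply setof_elim; [exact D|]. exact (hmem_eq _ _ _ _ _ (heq_refl _ _) K M).
      * apply (hmem_eq _ _ _ _ _ (heq_refl _ _) (heq_sym _ _ _ K)).
        apply setof_intro; assumption.
  - apply (Def_all n). apply Def_iff.
    + apply (Def_mem _ n); apply DefT_var; reflexivity.
    + apply (Def_ren (fun i => match i with 0 => 0 | S j => S (S j) end) _
           (vcons n (vcons (S n) e))) in H; [exact H|].
      intros [|i]; reflexivity.
Qed.

Lemma Def_definable n F : Def (vcons n (fun _ => 0)) (fun r => F (r 0)) -> definable F.
Proof. intros H; exact (definable_Def n (fun _ => 0) (fun _ => F) (fun _ => name 0) H). Qed.

(** * Stratification by type inference *)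

Ltac head t := match t with ?f _ => head f | _ => t end.

Ltac unfold_body P :=
  let b := eval cbv beta in (P (fun _ => name 0)) in let h := head b in unfold h.

(** Extended below with the sets whose definability is a lemma. *)
Ltac DefT_known X := fail.

Ltac def_step :=
  cbv beta delta [tl];
  lazymatch goal with
  | |- DefT _ _ ?X =>
    lazymatch X with
    | fun _ => ?c => apply DefT_const
    | fun r => r _ => apply DefT_var; cbn [vcons]; reflexivity
    | fun r => setof _ => eapply DefT_setof
    | _ => first [DefT_known X | unfold_body X]
    end
  | |- Def _ ?P =>
    lazymatch P with
    | fun r => hbot => apply Def_bot
    | fun r => hand _ _ => apply Def_and
    | fun r => hor _ _ => apply Def_or
    | fun r => himp _ _ => apply Def_imp
    | fun r => hiff _ _ => apply Def_iff
    | fun r => hall _ => eapply Def_all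
    | fun r => hex _ => eapply Def_ex
    | fun r => hmem _ _ => eapply Def_mem
    | fun r => heq _ _ => eapply Def_eq
    | _ => unfold_body P
    end
  end.

(** Indices are existential variables fixed by unification along the formula; those left
    undetermined become 0. *)
Ltac solve_definable := (unshelve (eapply Def_definable; repeat def_step)); exact 0.

Tactic Notation "set_in" := apply setof_intro; [solve_definable|].
Tactic Notation "set_in" "in" ident(H) := apply setof_elim in H; [|solve_definable].

(** [hrew H] replaces the left side of the equation [H] by its right side. *)
Ltac rewrite_goal X Y E :=
  match goal with |- holds ?G ?w =>
    match eval pattern X in G with ?P _ =>
      apply (definable_cong P w Y X); [solve_definable|exact E|cbv beta]
    end
  end.
Ltac rewrite_hyp X Y E K :=
  match type of K with holds ?G ?w =>
    match eval pattern X in G with ?P _ =>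
      apply (definable_cong P w X Y) in K; [|solve_definable|exact E]; cbv beta in K
    end
  end.
Tactic Notation "hrew" constr(H) :=
  match type of H with holds (heq ?X ?Y) _ => rewrite_goal X Y (heq_sym _ _ _ H) end.
Tactic Notation "hrew" "<-" constr(H) :=
  match type of H with holds (heq ?X ?Y) _ => rewrite_goal Y X H end.
Tactic Notation "hrew" constr(H) "in" ident(K) :=
  match type of H with holds (heq ?X ?Y) _ => rewrite_hyp X Y H K end.
Tactic Notation "hrew" "<-" constr(H) "in" ident(K) :=
  match type of H with holds (heq ?X ?Y) _ => rewrite_hyp Y X (heq_sym _ _ _ H) K end.

Global Opaque setof hmem heq.

(** * The notions of the theorem inside the model *)

Definition empty : set := ⦃ z | hbot ⦄.
Definition sing (x : set) : set := ⦃ z | z ≡ x ⦄.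
Definition upair (x y : set) : set := ⦃ z | z ≡ x ∨ z ≡ y ⦄.
Definition union (x y : set) : set := ⦃ z | z ∈ x ∨ z ∈ y ⦄.
Definition pair (x y : set) : set := upair (sing x) (upair x y).

Notation "⟨ x , y ⟩" := (pair x y) : hp_scope.

(** With this rule [def_step] treats pairs as primitive instead of unfolding their nested
    abstracts. *)
Lemma DefT_pair e n X Y : DefT e n X -> DefT e n Y -> DefT e (S (S n)) (fun r => ⟨X r, Y r⟩).
Proof.
  intros HX HY. unfold pair, upair, sing.
  apply DefT_setof, Def_or; eapply Def_eq; try (apply DefT_var; reflexivity);
    apply DefT_setof; try apply Def_or; eapply Def_eq; try (apply DefT_var; reflexivity);
    apply (DefT_tl _ _ n (fun r => X (tl r))) || apply (DefT_tl _ _ n (fun r => Y (tl r)));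
    apply DefT_tl; assumption.
Qed.

Ltac DefT_known X ::=
  lazymatch X with
  | fun r => pair _ _ => apply DefT_pair
  end.

Lemma in_sing w z x : w ⊩ z ∈ sing x <-> w ⊩ z ≡ x.
Proof. split; intros H; [set_in in H; exact H|set_in; exact H]. Qed.

Lemma in_upair w z x y : w ⊩ z ∈ upair x y <-> w ⊩ z ≡ x ∨ z ≡ y.
Proof. split; intros H; [set_in in H; exact H|set_in; exact H]. Qed.

Lemma in_union w z x y : w ⊩ z ∈ union x y <-> w ⊩ z ∈ x ∨ z ∈ y.
Proof. split; intros H; [set_in in H; exact H|set_in; exact H]. Qed.

Lemma in_empty w z R : w ⊩ z ∈ empty -> w ⊩ R.
Proof. intros H. apply bot_elim. set_in in H. exact H. Qed.

Lemma in_pair w z x y : w ⊩ z ∈ ⟨x, y⟩ <-> w ⊩ z ≡ sing x ∨ z ≡ upair x y.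
Proof. apply in_upair. Qed.

Global Opaque pair.

Definition FUNC : set :=
  ⦃ f | ∀ x y z, ⟨x, y⟩ ∈ f ⇒ ⟨x, z⟩ ∈ f ⇒ y ≡ z ⦄.

Definition Ap (f x : set) : set := ⦃ t | ∃ y, ⟨x, y⟩ ∈ f ∧ t ∈ y ⦄.

Definition subset (x y : set) : hp := ∀ z, z ∈ x ⇒ z ∈ y.

Definition bijection (f x y : set) : hp :=
  (∀ u, u ∈ f ⇒ ∃ a b, u ≡ ⟨a, b⟩ ∧ a ∈ x ∧ b ∈ y) ∧
  f ∈ FUNC ∧
  (∀ a, a ∈ x ⇒ ∃ b, ⟨a, b⟩ ∈ f) ∧
  (∀ a b c, ⟨a, c⟩ ∈ f ⇒ ⟨b, c⟩ ∈ f ⇒ a ≡ b) ∧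
  (∀ b, b ∈ y ⇒ ∃ a, ⟨a, b⟩ ∈ f).

Definition similar (x y : set) : hp := ∃ f, bijection f x y.

Definition infinite (x : set) : hp :=
  ∃ y, subset y x ∧ ¬ (y ≡ x) ∧ similar x y.

Definition idset : set := ⦃ v | ∃ x, v ≡ ⟨x, x⟩ ∧ x ≡ x ⦄.

Definition church_zero : set := ⦃ v | ∃ f, v ≡ ⟨f, idset⟩ ∧ f ≡ f ⦄.

Definition church_succ_val (z : set) : set :=
  ⦃ v | ∃ f p, v ≡ ⟨f, p⟩ ∧ f ∈ FUNC ∧
    (∀ u, u ∈ p ⇔
      (∃ x w t q, u ≡ ⟨x, w⟩ ∧ t ∈ FUNC ∧ ⟨f, t⟩ ∈ z ∧
                 ⟨x, q⟩ ∈ t ∧ ⟨q, w⟩ ∈ f)) ⦄.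

Definition church_succ : set :=
  ⦃ v | ∃ z, v ≡ ⟨z, church_succ_val z⟩ ∧ z ∈ FUNC ⦄.

Definition churchN : set :=
  ⦃ n | ∀ w, church_zero ∈ w ∧ (∀ x, x ∈ w ⇒ Ap church_succ x ∈ w) ⇒ n ∈ w ⦄.

Definition frege_zero : set := sing empty.

Definition frege_succ (x : set) : set :=
  ⦃ v | ∃ u c, v ≡ union u (sing c) ∧ u ∈ x ∧ ¬ (c ∈ u) ⦄.

Definition fregeF : set :=
  ⦃ n | ∀ w,
    frege_zero ∈ w ∧
    (∀ x, x ∈ w ∧ (∃ u, u ∈ frege_succ x) ⇒ frege_succ x ∈ w) ⇒ n ∈ w ⦄.

(** [XSet p q] is the elimination of the abstract {x : p} from the context [q];
    unlike its expansion, [xsem] interprets it by an element of the model. *)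
Inductive xform : Type :=
| XEq (x y : nat)
| XMem (x y : nat)
| XBot
| XAnd (p q : xform)
| XOr (p q : xform)
| XImp (p q : xform)
| XIff (p q : xform)
| XAll (p : xform)
| XEx (p : xform)
| XSet (p q : xform).

Fixpoint expand (p : xform) : form :=
  match p with
  | XEq x y => Eq x y
  | XMem x y => Mem x y
  | XBot => Bot
  | XAnd p q => And (expand p) (expand q)
  | XOr p q => Or (expand p) (expand q)
  | XImp p q => Imp (expand p) (expand q)
  | XIff p q => Iff (expand p) (expand q)
  | XAll p => All (expand p)
  | XEx p => Ex (expand p)
  | XSet p q => Ex (And (All (Iff (Mem 0 1) (ren (up S) (expand p)))) (expand q))
  end.

(** A heuristic inverse of [expand]: every conjunction of two implications is read as an
    equivalence, of which one copy is kept, and the new set is assumed absent from its defining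
    formula. The main theorem validates the result by comparing its expansion with the original
    formula. *)
Fixpoint compress (r : nat -> nat) (p : form) : xform :=
  match p with
  | Eq x y => XEq (r x) (r y)
  | Mem x y => XMem (r x) (r y)
  | Bot => XBot
  | And (Imp p q) (Imp _ _) => XIff (compress r p) (compress r q)
  | And p q => XAnd (compress r p) (compress r q)
  | Or p q => XOr (compress r p) (compress r q)
  | Imp p q => XImp (compress r p) (compress r q)
  | All p => XAll (compress (up r) p)
  | Ex (And (All (And (Imp (Mem 0 1) p) (Imp _ (Mem 0 1)))) q) =>
      XSet (compress (fun i => match i with 0 | 1 => 0 | S (S i) => S (r i) end) p)
        (compress (up r) q)
  | Ex p => XEx (compress (up r) p)
  end.

Fixpoint xsem (p : xform) (r : nat -> set) : hp :=
  match p with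
  | XEq x y => r x ≡ r y
  | XMem x y => r x ∈ r y
  | XBot => hbot
  | XAnd p q => xsem p r ∧ xsem q r
  | XOr p q => xsem p r ∨ xsem q r
  | XImp p q => xsem p r ⇒ xsem q r
  | XIff p q => xsem p r ⇔ xsem q r
  | XAll p => ∀ X, xsem p (vcons X r)
  | XEx p => ∃ X, xsem p (vcons X r)
  | XSet p q => xsem q (vcons (setof (fun X => xsem p (vcons X r))) r)
  end.

Fixpoint xstrat (e : nat -> nat) (p : xform) : Prop :=
  match p with
  | XEq x y => e x = e y
  | XMem x y => e y = S (e x)
  | XBot => True
  | XAnd p q | XOr p q | XImp p q | XIff p q => xstrat e p /\ xstrat e q
  | XAll p | XEx p => exists n, xstrat (scons n e) p
  | XSet p q => exists n, xstrat (scons n e) p /\ xstrat (scons (S n) e) q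
  end.

Lemma xstrat_expand p : forall e, xstrat e p -> strat e (expand p).
Proof.
  induction p; cbn; intros e; auto; try (intros [? ?]; repeat split; auto; fail).
  - intros [n ?]; exists n; auto.
  - intros [n ?]; exists n; auto.
  - intros (n & H & K). exists (S n); split; [|auto].
    assert (strat (scons n (scons (S n) e)) (ren (up S) (expand p1))).
    { eapply strat_ren; [|exact (IHp1 _ H)]. intros [|i] _; reflexivity. }
    exists n; auto.
Qed.

(** For [XSet], [xstrat] makes the abstract definable, so [setof] witnesses the existential, and by
    extensionality any other witness equals it. *)
Lemma xsem_correct p : forall e r w,
  xstrat e p -> w ⊩ xsem p r <-> w ⊩ sem (expand p) r.
Proof.
  induction p; cbn -[holds heq hmem hand hor himp hall hex]; intros e r w St;
    try tauto; repeat match goal with H : _ /\ _ |- _ => destruct H end.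
  - split; intros [? ?]; split; try eapply IHp1; try eapply IHp2; eauto.
  - split; intros K; apply (or_elim _ _ _ _ K); intros w' L K';
      try (hleft; eapply IHp1; eauto; fail); hright; eapply IHp2; eauto.
  - split; intros K w' L K'; eapply IHp2; eauto; apply K; auto; eapply IHp1; eauto.
  - split; intros [K1 K2]; split; intros w' L K.
    1, 3: eapply IHp2; eauto; apply K1; auto; eapply IHp1; eauto.
    all: eapply IHp1; eauto; apply K2; auto; eapply IHp2; eauto.
  - destruct St as [n St]. split; intros K X; eapply IHp; eauto; apply K.
  - destruct St as [n St].
    split; intros K; apply (ex_elim _ _ _ K); intros w' X L K'; hexists X;
      eapply IHp; eauto.
  - destruct St as (n & St1 & St2).
    assert (D : definable (fun X => xsem p1 (vcons X r))).
    { exists (expand p1), r; split; [exists (scons n e); apply xstrat_expand, St1|].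
      intros; eapply IHp1; exact St1. }
    assert (E : forall A X w, w ⊩ sem (ren (up S) (expand p1)) (vcons X (vcons A r)) <->
                        w ⊩ xsem p1 (vcons X r)).
    { intros A X v; rewrite sem_ren, IHp1 by exact St1.
      split; apply sem_ext; intros [|i]; reflexivity. }
    rewrite IHp2 by exact St2. split.
    + intros K. hexists (setof (fun X => xsem p1 (vcons X r))). split; [|exact K].
      intros X; split; intros w' L M.
      * apply E; exact (setof_elim _ _ _ D M).
      * apply setof_intro; [exact D|]. apply E in M; exact M.
    + intros K. hdes K as A (K1 & K2). revert K2. apply sem_cong.
      intros [|i] _; [|apply heq_refl]. apply extensionality; intros X.
      destruct (K1 X) as [H1 H2]. hsplit; intros M.
      * apply setof_intro; [exact D|]. apply (E A), (mp _ _ _ H1), M.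
      * apply (mp _ _ _ H2), E. exact (setof_elim _ _ _ D M).
Qed.

Lemma xform_provable p e : xstrat e p -> (forall r, nil ⊩ xsem p r) -> prv INF nil (expand p).
Proof.
  intros S H. rewrite <- (ren_id (expand p)). apply sem_name, (xsem_correct p e); auto.
Qed.

Definition frege_closed : hp := ∀ x, x ∈ fregeF ⇒ frege_succ x ∈ fregeF.
Definition conclusion : hp :=
  infinite churchN ∧
    (∀ x y, x ∈ churchN ⇒ y ∈ churchN ⇒
      Ap church_succ x ≡ Ap church_succ y ⇒ x ≡ y).

(** * Pairs, functions and Church numbers *)

Lemma pair_inj1 w x y a b : w ⊩ ⟨x, y⟩ ≡ ⟨a, b⟩ -> w ⊩ x ≡ a.
Proof.
  intros H. assert (K : w ⊩ sing x ∈ ⟨a, b⟩).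
  { hrew <- H. apply in_pair. hleft. apply heq_refl. }
  apply in_pair in K. assert (L : w ⊩ a ∈ sing x).
  { hcase K as K; hrew K; [apply in_sing|apply in_upair; hleft]; apply heq_refl. }
  apply heq_sym, in_sing, L.
Qed.

(** Equality is not decidable, so there is no split on x = y. Memberships yield y = x or y = b, and
    b = x or b = y; every combination gives y = b. *)
Lemma pair_inj2 w x y a b : w ⊩ ⟨x, y⟩ ≡ ⟨a, b⟩ -> w ⊩ y ≡ b.
Proof.
  intros H. pose proof (pair_inj1 _ _ _ _ _ H) as E.
  assert (K : w ⊩ upair x y ∈ ⟨a, b⟩).
  { hrew <- H. apply in_pair. hright. apply heq_refl. }
  assert (L : w ⊩ upair a b ∈ ⟨x, y⟩).
  { hrew H. apply in_pair. hright. apply heq_refl. }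
  apply in_pair in K, L.
  assert (Y : w ⊩ y ≡ x ∨ y ≡ b).
  { assert (M : w ⊩ y ∈ upair x y) by (apply in_upair; hright; apply heq_refl).
    hcase K as K; hrew K in M.
    - hleft. hrew E. apply in_sing, M.
    - hrew E. apply in_upair, M. }
  assert (B : w ⊩ b ≡ x ∨ b ≡ y).
  { assert (M : w ⊩ b ∈ upair a b) by (apply in_upair; hright; apply heq_refl).
    hcase L as L; hrew L in M.
    - hleft. apply in_sing, M.
    - apply in_upair, M. }
  hcase Y as Y; [|exact Y].
  hcase B as B; [|apply heq_sym, B].
  hrew Y. apply heq_sym, B.
Qed.

Lemma FUNC_elim w f x y z : w ⊩ f ∈ FUNC -> w ⊩ ⟨x, y⟩ ∈ f -> w ⊩ ⟨x, z⟩ ∈ f -> w ⊩ y ≡ z.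
Proof. intros H Hy Hz. set_in in H. exact (mp _ _ _ (mp _ _ _ (H x y z) Hy) Hz). Qed.

Lemma FUNC_intro w f :
  (forall w' x y z, incl w w' -> w' ⊩ ⟨x, y⟩ ∈ f -> w' ⊩ ⟨x, z⟩ ∈ f -> w' ⊩ y ≡ z) ->
  w ⊩ f ∈ FUNC.
Proof.
  intros H. set_in. intros x y z v L Hy v' L' Hz. apply (H v' x y z).
  - eapply incl_tran; eassumption.
  - apply (mono _ _ _ L' Hy).
  - exact Hz.
Qed.

Lemma in_idset w x y : w ⊩ ⟨x, y⟩ ∈ idset <-> w ⊩ x ≡ y.
Proof.
  split; intros H.
  - set_in in H. hdes H as z (H & _).
    hrew (pair_inj1 _ _ _ _ _ H). hrew (pair_inj2 _ _ _ _ _ H). apply heq_refl.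
  - set_in. hexists x. hrew H. split; apply heq_refl.
Qed.

Lemma idset_FUNC w : w ⊩ idset ∈ FUNC.
Proof.
  apply FUNC_intro; intros v x y z _ Hy Hz. apply in_idset in Hy, Hz.
  hrew <- Hy. exact Hz.
Qed.

Lemma in_church_zero w f t : w ⊩ ⟨f, t⟩ ∈ church_zero <-> w ⊩ t ≡ idset.
Proof.
  split; intros H.
  - set_in in H. hdes H as g (H & _). apply (pair_inj2 _ _ _ _ _ H).
  - set_in. hexists f. hrew H. split; apply heq_refl.
Qed.

Lemma church_zero_FUNC w : w ⊩ church_zero ∈ FUNC.
Proof.
  apply FUNC_intro; intros v x y z _ Hy Hz. apply in_church_zero in Hy, Hz.
  hrew Hz. exact Hy.
Qed.

Definition comp_step (z f u : set) : hp :=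
  ∃ x w t q, u ≡ ⟨x, w⟩ ∧ t ∈ FUNC ∧ ⟨f, t⟩ ∈ z ∧ ⟨x, q⟩ ∈ t ∧ ⟨q, w⟩ ∈ f.

Lemma in_church_succ_val w z f p :
  w ⊩ ⟨f, p⟩ ∈ church_succ_val z <->
  w ⊩ f ∈ FUNC ∧ (∀ u, u ∈ p ⇔ comp_step z f u).
Proof.
  split; intros H.
  - set_in in H. hdes H as g H. hdes H as q (E & F & H).
    hrew (pair_inj1 _ _ _ _ _ E). hrew (pair_inj2 _ _ _ _ _ E). split; [exact F|exact H].
  - destruct H as [F H]. set_in. hexists f. hexists p.
    split; [apply heq_refl|]. split; [exact F|exact H].
Qed.

Lemma church_succ_val_FUNC w z : w ⊩ church_succ_val z ∈ FUNC.
Proof.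
  apply FUNC_intro; intros v f t t' _ H H'. apply in_church_succ_val in H, H'.
  destruct H as [_ H], H' as [_ H']. apply extensionality; intros u.
  hsplit; intros K.
  - apply (iff2 _ _ _ (H' u)), (iff1 _ _ _ (H u)), K.
  - apply (iff2 _ _ _ (H u)), (iff1 _ _ _ (H' u)), K.
Qed.

(** [f] iterated according to the Church number [n] maps [x] to [y]. *)
Definition iter (n f x y : set) : hp :=
  ∃ t, t ∈ FUNC ∧ ⟨f, t⟩ ∈ n ∧ ⟨x, y⟩ ∈ t.

Lemma iter_zero w f x y : w ⊩ iter church_zero f x y <-> w ⊩ x ≡ y.
Proof.
  split; intros H.
  - hdes H as t (_ & H & K). apply in_church_zero in H. hrew H in K. apply in_idset, K.
  - hexists idset. split; [apply idset_FUNC|]. split; [apply in_church_zero, heq_refl|].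
    apply in_idset, H.
Qed.

Lemma iter_succ_val_elim w n f x y :
  w ⊩ iter (church_succ_val n) f x y -> w ⊩ ∃ q, iter n f x q ∧ ⟨q, y⟩ ∈ f.
Proof.
  intros H. hdes H as t (_ & H & K). apply in_church_succ_val in H.
  destruct H as [_ H]. apply (iff1 _ _ _ (H _)) in K.
  hdes K as x' K. hdes K as y' K. hdes K as s K. hdes K as q (E & F & K1 & K2 & K3).
  hexists q. hrew (pair_inj1 _ _ _ _ _ E). hrew (pair_inj2 _ _ _ _ _ E).
  split; [|exact K3]. hexists s. split; [exact F|]. split; [exact K1|exact K2].
Qed.

Lemma iter_succ_val_intro w n f x q y : w ⊩ n ∈ FUNC -> w ⊩ f ∈ FUNC ->
  w ⊩ iter n f x q -> w ⊩ ⟨q, y⟩ ∈ f -> w ⊩ iter (church_succ_val n) f x y.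
Proof.
  intros N F H K. set (p := ⦃ u | comp_step n f u ⦄).
  assert (P : forall w u, w ⊩ u ∈ p <-> w ⊩ comp_step n f u).
  { split; intros M; [apply setof_elim in M; [exact M|]|apply setof_intro; [|exact M]];
      solve_definable. }
  hexists p. repeat split.
  - apply FUNC_intro; intros v x0 y1 y2 L H1 H2. advance L. apply P in H1, H2.
    hdes H1 as x1 H1. hdes H1 as w1 H1. hdes H1 as t1 H1. hdes H1 as q1 (E1 & F1 & A1 & B1 & C1).
    hdes H2 as x2 H2. hdes H2 as w2 H2. hdes H2 as t2 H2. hdes H2 as q2 (E2 & F2 & A2 & B2 & C2).
    hrew (pair_inj2 _ _ _ _ _ E1). hrew (pair_inj2 _ _ _ _ _ E2).
    hrew <- (pair_inj1 _ _ _ _ _ E1) in B1. hrew <- (pair_inj1 _ _ _ _ _ E2) in B2.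
    (* [N] identifies the two iterates, [F2] their values at the common argument, and [F] the final
       values. *)
    hrew (FUNC_elim _ _ _ _ _ N A1 A2) in B1.
    hrew (FUNC_elim _ _ _ _ _ F2 B1 B2) in C1.
    apply (FUNC_elim _ _ _ _ _ F C1 C2).
  - apply in_church_succ_val. split; [exact F|]. intros u; hsplit; apply P.
  - apply P. hdes H as t (H1 & H2 & H3).
    hexists x. hexists y. hexists t. hexists q.
    split; [apply heq_refl|]. split; [exact H1|]. split; [exact H2|]. split; [exact H3|exact K].
Qed.

Lemma church_succ_eq w x : w ⊩ x ∈ FUNC -> w ⊩ Ap church_succ x ≡ church_succ_val x.
Proof.
  intros F. apply extensionality; intros t. hsplit; intros H.
  - set_in in H. hdes H as y (H & K). set_in in H. hdes H as z (H & _).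
    hrew (pair_inj1 _ _ _ _ _ H). hrew <- (pair_inj2 _ _ _ _ _ H). exact K.
  - set_in. hexists (church_succ_val x). split; [|exact H].
    set_in. hexists x. split; [apply heq_refl|exact F].
Qed.

Lemma churchN_zero w : w ⊩ church_zero ∈ churchN.
Proof. set_in. intros A. himp H. exact (proj1 H). Qed.

Lemma churchN_succ w x : w ⊩ x ∈ churchN -> w ⊩ Ap church_succ x ∈ churchN.
Proof.
  intros H. set_in. set_in in H. intros A. himp K.
  apply (mp _ _ _ (proj2 K x)), (mp _ _ _ (H A)), K.
Qed.

(** An intersection of closed sets gives only [P x] in the step; where x in N is required too, it is
    conjoined to the predicate. *)
Lemma churchN_ind (P : set -> hp) w : definable P -> w ⊩ P church_zero ->
  (forall w' x, incl w w' -> w' ⊩ P x -> w' ⊩ P (Ap church_succ x)) ->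
  forall n, w ⊩ n ∈ churchN -> w ⊩ P n.
Proof.
  intros D H0 HS n H. set_in in H. apply (setof_elim P w n D).
  apply (mp _ _ _ (H (setof P))). split; [apply setof_intro; assumption|].
  intros x v L K. apply setof_intro; [exact D|]. apply HS; [exact L|].
  apply (setof_elim P v x D K).
Qed.

Lemma churchN_FUNC w n : w ⊩ n ∈ churchN -> w ⊩ n ∈ FUNC.
Proof.
  revert n. apply churchN_ind; [solve_definable|apply church_zero_FUNC|].
  intros v x L H. hrew (church_succ_eq _ _ H). apply church_succ_val_FUNC.
Qed.

Lemma churchN_cases w n : w ⊩ n ∈ churchN ->
  w ⊩ n ≡ church_zero ∨ (∃ m, m ∈ churchN ∧ n ≡ Ap church_succ m).
Proof.
  intros H. assert (K : w ⊩ n ∈ churchN ∧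
    (n ≡ church_zero ∨ (∃ m, m ∈ churchN ∧ n ≡ Ap church_succ m))); [|exact (proj2 K)].
  revert n H. apply (churchN_ind (fun n => n ∈ churchN ∧
    (n ≡ church_zero ∨ (∃ m, m ∈ churchN ∧ n ≡ Ap church_succ m)))).
  - solve_definable.
  - split; [apply churchN_zero|]. hleft. apply heq_refl.
  - intros v x L [H _]. split; [apply churchN_succ, H|]. hright. hexists x.
    split; [exact H|apply heq_refl].
Qed.

Lemma iter_succ_elim w n f x y : w ⊩ n ∈ churchN ->
  w ⊩ iter (Ap church_succ n) f x y -> w ⊩ ∃ q, iter n f x q ∧ ⟨q, y⟩ ∈ f.
Proof.
  intros N H. apply iter_succ_val_elim.
  hrew <- (church_succ_eq _ _ (churchN_FUNC _ _ N)). exact H.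
Qed.

Lemma iter_succ_intro w n f x q y : w ⊩ n ∈ churchN -> w ⊩ f ∈ FUNC ->
  w ⊩ iter n f x q -> w ⊩ ⟨q, y⟩ ∈ f -> w ⊩ iter (Ap church_succ n) f x y.
Proof.
  intros N F H K. apply churchN_FUNC in N. hrew (church_succ_eq _ _ N).
  apply (iter_succ_val_intro _ _ _ _ q); assumption.
Qed.

(** * Injective relations and chains in finite cardinals *)

Definition injective (f : set) : hp := ∀ x y z, ⟨x, z⟩ ∈ f ⇒ ⟨y, z⟩ ∈ f ⇒ x ≡ y.
Definition source (f a : set) : hp := ∀ x, ¬ (⟨x, a⟩ ∈ f).

Lemma injective_elim w f x y z :
  w ⊩ injective f -> w ⊩ ⟨x, z⟩ ∈ f -> w ⊩ ⟨y, z⟩ ∈ f -> w ⊩ x ≡ y.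
Proof. intros H K L. exact (mp _ _ _ (mp _ _ _ (H x y z) K) L). Qed.

Lemma source_elim w f a x R : w ⊩ source f a -> w ⊩ ⟨x, a⟩ ∈ f -> w ⊩ R.
Proof. intros H K. exact (bot_elim _ _ (mp _ _ _ (H x) K)). Qed.

(** Induction on [n] with [m] and [b] quantified, since cancelling one [f] changes both. Zero facing
    a successor would give the source [a] a predecessor. *)
Lemma iter_determines w n m f a b : w ⊩ n ∈ churchN -> w ⊩ m ∈ churchN ->
  w ⊩ injective f -> w ⊩ source f a ->
  w ⊩ iter n f a b -> w ⊩ iter m f a b -> w ⊩ n ≡ m.
Proof.
  intros N M I S Hn Hm.
  assert (K : w ⊩ n ∈ churchN ∧ (∀ m f a b, m ∈ churchN ⇒ injective f ⇒ source f a ⇒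
    iter n f a b ⇒ iter m f a b ⇒ n ≡ m)).
  2: { exact (mp _ _ _ (mp _ _ _ (mp _ _ _ (mp _ _ _ (mp _ _ _
         (proj2 K m f a b) M) I) S) Hn) Hm). }
  clear m f a b M I S Hn Hm. revert n N.
  apply (churchN_ind (fun n => n ∈ churchN ∧ (∀ m f a b,
    m ∈ churchN ⇒ injective f ⇒ source f a ⇒ iter n f a b ⇒ iter m f a b ⇒ n ≡ m))).
  - solve_definable.
  - split; [apply churchN_zero|]. intros m f a b.
    himp M. himp I. himp S. himp Hn. himp Hm. apply iter_zero in Hn.
    apply churchN_cases in M. hcase M as M; [apply heq_sym, M|].
    hdes M as m' (M & E). hrew E in Hm. apply iter_succ_elim in Hm; [|exact M].
    hdes Hm as q (_ & Hm). hrew <- Hn in Hm. apply (source_elim _ _ _ _ _ S Hm).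
  - intros v n L [N IH]. clear w L. rename v into w.
    split; [apply churchN_succ, N|]. intros m f a b.
    himp M. himp I. himp S. himp Hn. himp Hm.
    apply iter_succ_elim in Hn; [|exact N]. hdes Hn as p (Hp & Hn).
    apply churchN_cases in M. hcase M as M.
    + hrew M in Hm. apply iter_zero in Hm. hrew <- Hm in Hn.
      apply (source_elim _ _ _ _ _ S Hn).
    + hdes M as m' (M & E). hrew E in Hm. apply iter_succ_elim in Hm; [|exact M].
      hdes Hm as q (Hq & Hm). hrew <- (injective_elim _ _ _ _ _ I Hn Hm) in Hq.
      assert (D : w ⊩ n ≡ m').
      { exact (mp _ _ _ (mp _ _ _ (mp _ _ _ (mp _ _ _ (mp _ _ _
         (IH m' f a p) M) I) S) Hp) Hq). }
      hrew D. apply heq_sym, E.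
Qed.

(** Carries an iteration over to a lengthened chain. The values of [n] at [f] and at [g] are
    separate relations, so an induction is needed. *)
Lemma iter_subset w n f g x y : w ⊩ n ∈ churchN -> w ⊩ g ∈ FUNC -> w ⊩ subset f g ->
  w ⊩ iter n f x y -> w ⊩ iter n g x y.
Proof.
  intros N G S H.
  assert (K : w ⊩ n ∈ churchN ∧ (∀ y, iter n f x y ⇒ iter n g x y)).
  2: { exact (mp _ _ _ (proj2 K y) H). }
  clear y H. revert n N.
  apply (churchN_ind (fun n => n ∈ churchN ∧ (∀ y, iter n f x y ⇒ iter n g x y))).
  - solve_definable.
  - split; [apply churchN_zero|]. intros y. himp H. apply iter_zero in H. apply iter_zero, H.
  - intros v n L [N IH]. advance L. split; [apply churchN_succ, N|]. intros y. himp H.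
    apply iter_succ_elim in H; [|exact N]. hdes H as q (H & K).
    apply (iter_succ_intro _ _ _ _ q); [exact N|exact G| |].
    + apply (mp _ _ _ (IH q) H).
    + apply (mp _ _ _ (S _) K).
Qed.

(** In [u], iterating the injection [f] leads from [a] to the dead end [b]. *)
Definition chain (u f a b : set) : hp :=
  f ∈ FUNC ∧ injective f ∧ source f a ∧ a ∈ u ∧ b ∈ u ∧
  (∀ x y, ⟨x, y⟩ ∈ f ⇒ x ∈ u ∧ y ∈ u ∧ ¬ (x ≡ b)).

(** All members of [k] are required to carry a chain, because a given member of [frege_succ k]
    dictates which member of [k] is extended. That there is a member comes from
    [fregeF_inhabited]. *)
Definition realized (n : set) : hp :=
  ∃ k, k ∈ fregeF ∧ (∀ u, u ∈ k ⇒ ∃ f a b, chain u f a b ∧ iter n f a b).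

Lemma in_frege_succ w v x : w ⊩ v ∈ frege_succ x ->
  w ⊩ ∃ u c, v ≡ union u (sing c) ∧ u ∈ x ∧ ¬ (c ∈ u).
Proof. intros H. set_in in H. exact H. Qed.

Lemma fregeF_zero w : w ⊩ frege_zero ∈ fregeF.
Proof. set_in. intros A. himp H. exact (proj1 H). Qed.

(** The closure clause of [fregeF] adds only inhabited successors. *)
Lemma fregeF_inhabited w k : w ⊩ k ∈ fregeF -> w ⊩ ∃ u, u ∈ k.
Proof.
  intros H. set_in in H. apply (setof_elim (fun k => ∃ u, u ∈ k)); [solve_definable|].
  apply (mp _ _ _ (H ⦃ k | ∃ u, u ∈ k ⦄)). split.
  - set_in. hexists empty. apply in_sing, heq_refl.
  - intros x. himp K. set_in. exact (proj2 K).
Qed.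

Lemma in_chain w g b c x y :
  w ⊩ ⟨x, y⟩ ∈ union g (sing ⟨b, c⟩) -> w ⊩ ⟨x, y⟩ ∈ g ∨ (x ≡ b ∧ y ≡ c).
Proof.
  intros H. apply in_union in H. hcase H as H; [hleft; exact H|hright].
  apply in_sing in H. split; [apply (pair_inj1 _ _ _ _ _ H)|apply (pair_inj2 _ _ _ _ _ H)].
Qed.

(** The relation stays functional because [b] was a dead end; freshness of [c] preserves injectivity
    and the source and makes [c] the new dead end. *)
Lemma chain_extend w u v f a b c : w ⊩ chain u f a b -> w ⊩ ¬ (c ∈ u) ->
  w ⊩ v ≡ union u (sing c) -> w ⊩ chain v (union f (sing ⟨b, c⟩)) a c.
Proof.
  intros (F & I & S & A & B & R) C V.
  assert (U : w ⊩ ∀ x, x ∈ u ⇒ x ∈ v).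
  { intros x. himp K. hrew V. apply in_union. hleft. exact K. }
  assert (Cv : w ⊩ c ∈ v).
  { hrew V. apply in_union. hright. apply in_sing, heq_refl. }
  unfold chain. repeat match goal with |- holds (hand _ _) _ => split end.
  - apply FUNC_intro; intros w' x y z L Hy Hz. advance L.
    apply in_chain in Hy, Hz. hcase Hy as Hy; hcase Hz as Hz.
    + apply (FUNC_elim _ _ _ _ _ F Hy Hz).
    + apply bot_elim, (mp _ _ _ (proj2 (proj2 (mp _ _ _ (R x y) Hy)))), (proj1 Hz).
    + apply bot_elim, (mp _ _ _ (proj2 (proj2 (mp _ _ _ (R x z) Hz)))), (proj1 Hy).
    + hrew (proj2 Hy). apply heq_sym, (proj2 Hz).
  - intros x y z. himp Hx. himp Hy.
    apply in_chain in Hx, Hy. hcase Hx as Hx; hcase Hy as Hy.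
    + apply (injective_elim _ _ _ _ _ I Hx Hy).
    + apply bot_elim, (mp _ _ _ C). hrew <- (proj2 Hy).
      exact (proj1 (proj2 (mp _ _ _ (R x z) Hx))).
    + apply bot_elim, (mp _ _ _ C). hrew <- (proj2 Hx).
      exact (proj1 (proj2 (mp _ _ _ (R y z) Hy))).
    + hrew (proj1 Hx). apply heq_sym, (proj1 Hy).
  - intros x. himp H. apply in_chain in H. hcase H as H.
    + apply (source_elim _ _ _ _ _ S H).
    + apply (mp _ _ _ C). hrew <- (proj2 H). exact A.
  - apply (mp _ _ _ (U a) A).
  - exact Cv.
  - intros x y. himp H. apply in_chain in H. hcase H as H.
    + destruct (mp _ _ _ (R x y) H) as (X & Y & _).
      split; [apply (mp _ _ _ (U x) X)|]. split; [apply (mp _ _ _ (U y) Y)|].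
      himp E. apply (mp _ _ _ C). hrew <- E. exact X.
    + destruct H as [X Y]. split; [hrew X; apply (mp _ _ _ (U b) B)|].
      split; [hrew Y; exact Cv|].
      himp E. apply (mp _ _ _ C). hrew <- E. hrew X. exact B.
Qed.

Lemma chain_singleton w u c : w ⊩ c ∈ u -> w ⊩ chain u empty c c.
Proof.
  intros H. unfold chain. repeat match goal with |- holds (hand _ _) _ => split end;
    try exact H.
  - apply FUNC_intro; intros v x y z _ K _. apply (in_empty _ _ _ K).
  - intros x y z. himp K. himp K'. apply (in_empty _ _ _ K).
  - intros x. himp K. apply (in_empty _ _ _ K).
  - intros x y. himp K. apply (in_empty _ _ _ K).
Qed.

(** Stepping from a cardinal [k] to [frege_succ k] lengthens every chain by the
    point that the members of [frege_succ k] have in addition. *)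
Lemma churchN_realized w n : w ⊩ frege_closed -> w ⊩ n ∈ churchN -> w ⊩ realized n.
Proof.
  intros H N.
  assert (K : w ⊩ n ∈ churchN ∧ realized n); [|exact (proj2 K)].
  revert n N. apply (churchN_ind (fun n => n ∈ churchN ∧ realized n)).
  - solve_definable.
  (* A chain without steps still needs a point, so the induction starts at the cardinal one. *)
  - split; [apply churchN_zero|]. hexists (frege_succ frege_zero).
    split; [apply (mp _ _ _ (H _)), fregeF_zero|].
    intros v. himp V. apply in_frege_succ in V.
    hdes V as u V. hdes V as c (V & _ & _). hexists empty. hexists c. hexists c.
    split; [|apply iter_zero, heq_refl].
    apply chain_singleton. hrew V. apply in_union. hright. apply in_sing, heq_refl.
  - intros w' n L [N K]. advance L. split; [apply churchN_succ, N|].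
    hdes K as k (Hk & K). hexists (frege_succ k).
    split; [apply (mp _ _ _ (H _) Hk)|].
    intros v. himp V. apply in_frege_succ in V.
    hdes V as u V. hdes V as c (V & U & C).
    pose proof (mp _ _ _ (K u) U) as M.
    hdes M as f M. hdes M as a M. hdes M as b (Ch & It).
    pose proof (chain_extend _ _ _ _ _ _ _ Ch C V) as Ch'.
    hexists (union f (sing ⟨b, c⟩)). hexists a. hexists c. split; [exact Ch'|].
    apply (iter_succ_intro _ _ _ _ b); [exact N|exact (proj1 Ch')| |].
    + apply (iter_subset _ _ f); [exact N|exact (proj1 Ch')| |exact It].
      intros z. himp Z. apply in_union. hleft. exact Z.
    + apply in_union. hright. apply in_sing, heq_refl.
Qed.

(** * Injectivity of the successor and infinity of N *)

Lemma church_succ_inj w x y : w ⊩ frege_closed -> w ⊩ x ∈ churchN -> w ⊩ y ∈ churchN ->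
  w ⊩ Ap church_succ x ≡ Ap church_succ y -> w ⊩ x ≡ y.
Proof.
  intros H X Y E.
  pose proof (churchN_realized _ _ H (churchN_succ _ _ X)) as K.
  hdes K as k (Hk & K). apply fregeF_inhabited in Hk. hdes Hk as u Hu.
  pose proof (mp _ _ _ (K u) Hu) as M.
  hdes M as f M. hdes M as a M. hdes M as b (Ch & It).
  destruct Ch as (_ & I & S & _).
  assert (It' : w ⊩ iter (Ap church_succ y) f a b) by (hrew <- E; exact It).
  apply iter_succ_elim in It; [|exact X]. apply iter_succ_elim in It'; [|exact Y].
  hdes It as p (Hp & Kp). hdes It' as q (Hq & Kq).
  hrew <- (injective_elim _ _ _ _ _ I Kp Kq) in Hq.
  apply (iter_determines _ _ _ _ _ _ X Y I S Hp Hq).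
Qed.

(** [church_zero] is defined at every set, [Ap church_succ x] only on [FUNC]. *)
Lemma church_zero_succ w x R : w ⊩ x ∈ churchN -> w ⊩ church_zero ≡ Ap church_succ x -> w ⊩ R.
Proof.
  intros X E. set (V := ⦃ x | x ≡ x ⦄).
  assert (In : w ⊩ ∀ x, x ∈ V) by (intros y; set_in; apply heq_refl).
  assert (K : w ⊩ ⟨V, idset⟩ ∈ Ap church_succ x).
  { hrew <- E. apply in_church_zero, heq_refl. }
  hrew (church_succ_eq _ _ (churchN_FUNC _ _ X)) in K.
  apply in_church_succ_val in K. destruct K as [K _].
  (* The universe [V] would be a function, yet it pairs [empty] with both [empty] and [V]. *)
  pose proof (FUNC_elim _ _ _ _ _ K (In ⟨empty, empty⟩) (In ⟨empty, V⟩)) as M.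
  pose proof (In empty) as N. hrew <- M in N. apply (in_empty _ _ _ N).
Qed.

Lemma church_infinite w : w ⊩ frege_closed -> w ⊩ conclusion.
Proof.
  intros H. split.
  2: { intros x y. himp X. himp Y. himp E. apply (church_succ_inj _ _ _ H X Y E). }
  set (Y := ⦃ v | ∃ x, x ∈ churchN ∧ v ≡ Ap church_succ x ⦄).
  set (g := ⦃ v | ∃ x, x ∈ churchN ∧ v ≡ ⟨x, Ap church_succ x⟩ ⦄).
  assert (Yi : forall w x, w ⊩ x ∈ churchN -> w ⊩ Ap church_succ x ∈ Y).
  { intros v x K. set_in. hexists x. split; [exact K|apply heq_refl]. }
  assert (Ye : forall w y, w ⊩ y ∈ Y -> w ⊩ ∃ x, x ∈ churchN ∧ y ≡ Ap church_succ x).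
  { intros v y K. set_in in K. exact K. }
  assert (gi : forall w x, w ⊩ x ∈ churchN -> w ⊩ ⟨x, Ap church_succ x⟩ ∈ g).
  { intros v x K. set_in. hexists x. split; [exact K|apply heq_refl]. }
  assert (ge : forall w x y, w ⊩ ⟨x, y⟩ ∈ g -> w ⊩ x ∈ churchN ∧ y ≡ Ap church_succ x).
  { intros v x y K. set_in in K. hdes K as z (K & E).
    hrew (pair_inj1 _ _ _ _ _ E). split; [exact K|apply (pair_inj2 _ _ _ _ _ E)]. }
  hexists Y. split; [|split].
  - intros y. himp K. apply Ye in K. hdes K as x (K & E). hrew E. apply churchN_succ, K.
  - himp E. pose proof (churchN_zero w) as K. hrew <- E in K. apply Ye in K.
    hdes K as x (K & E'). apply (church_zero_succ _ _ _ K E').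
  - hexists g. unfold bijection. split; [|split; [|split; [|split]]].
    + intros u. himp U. set_in in U. hdes U as x (U & E).
      hexists x. hexists (Ap church_succ x).
      split; [exact E|]. split; [exact U|apply Yi, U].
    + apply FUNC_intro; intros v x y z _ A B. apply ge in A, B.
      hrew (proj2 A). apply heq_sym, (proj2 B).
    + intros x. himp X. hexists (Ap church_succ x). apply gi, X.
    + intros a b c. himp A. himp B. apply ge in A, B. destruct A as [A A'], B as [B B'].
      apply (church_succ_inj _ _ _ H A B). hrew <- A'. exact B'.
    + intros y. himp K. apply Ye in K. hdes K as x (K & E). hexists x. hrew E. apply gi, K.
Qed.

End Model.

(** Computed once and for all, since the formula itself has about 700000 nodes. *)
Definition statement_xform : Model.xform := Eval vm_compute in
  Model.compress (fun i => i) (closed (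
    (∀ x, x ∈ fregeF ⇒ frege_succ x ∈ fregeF) ⇒
    infinite churchN ∧
    (∀ x y, x ∈ churchN ⇒ y ∈ churchN ⇒
      Ap church_succ x ≡ Ap church_succ y ⇒ x ≡ y))).

Lemma statement_xstrat : Model.xstrat (fun _ => 0) statement_xform.
Proof.
  unshelve (repeat match goal with
  | |- exists _, _ => eexists
  | |- _ /\ _ => split
  | |- True => exact I
  | |- _ = _ => cbn [scons]; reflexivity
  | _ => progress cbn [statement_xform Model.xstrat]
  end); exact 0.
Qed.

(** Since [xsem] puts an element of the model in place of each abstract, the context in which it was
    eliminated no longer matters and both sides unfold to the same value. *)
Lemma statement_xsem r :
  Model.xsem statement_xform r = Model.himp Model.frege_closed Model.conclusion.
Proof.
  cbv [statement_xform Model.xsem Model.vcons].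
  cbv [Model.frege_closed Model.conclusion Model.infinite Model.similar Model.bijection Model.subset
    Model.fregeF Model.frege_succ Model.frege_zero Model.churchN Model.church_succ
    Model.church_succ_val Model.church_zero Model.idset Model.Ap Model.FUNC
    Model.pair Model.union Model.upair Model.sing Model.empty].
  reflexivity.
Qed.

Lemma statement_holds r : Model.holds (Model.xsem statement_xform r) nil.
Proof. rewrite statement_xsem. intros w _; apply Model.church_infinite. Qed.

Theorem theorem20p11 :
  prv INF nil (closed (
    (∀ x, x ∈ fregeF ⇒ frege_succ x ∈ fregeF) ⇒
    infinite churchN ∧
    (∀ x y, x ∈ churchN ⇒ y ∈ churchN ⇒
      Ap church_succ x ≡ Ap church_succ y ⇒ x ≡ y))).
Proof.
  (* The kernel unfolds the formula lazily, which the unifier does not. *)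
  exact_no_check (Model.xform_provable _ _ statement_xstrat statement_holds).
Qed.
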